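(* Let $d$ denote the VC-dimension of visibility regions in simple polygons, i.e. the largest realizable number. Then $d \le 14$. Equivalently: for every simple polygon $P$ and every set $S$ of $15$ points in $P$, there exists a subset $T \subseteq S$ such that $T \neq \mathrm{vis}(v) \cap S$ for all points $v \in P$.
   Context: A simple polygon $P$ is understood as the closed region of the plane bounded by a simple closed polygonal curve. For $v \in P$, the visibility region of $v$ is $\mathrm{vis}(v) = \{x \in P : \overline{xv} \subset P\}$, where $\overline{xv}$ is the line segment joining $x$ and $v$. For a finite set $S \subset P$, a subset $T \subseteq S$ is called discernible if there is a point $v \in P$ with $T = \mathrm{vis}(v) \cap S$. A number $m$ is called realizable if there exist a simple polygon $P$ and a set $S$ of $m$ points in $P$ such that all subsets of $S$ are discernible. (If $m \ge 1$ is realizable, so is $m-1$.) *)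

(* Defs.v *)
From mathcomp Require Import all_boot all_order all_algebra.
From mathcomp Require Import all_classical all_reals all_analysis.

Set Implicit Arguments.
Unset Strict Implicit.
Unset Printing Implicit Defensive.

Import Order.TTheory GRing.Theory Num.Theory.
Import numFieldNormedType.Exports.

Local Open Scope classical_set_scope.
Local Open Scope card_scope.
Local Open Scope ring_scope.

Section SimplePolygons.
Variable R : realType.
Local Notation plane := (R * R)%type.

Definition affine_path (x y : plane) (t : R) : plane :=
  (1 - t) *: x + t *: y.

Definition segment (x y : plane) : set plane :=
  affine_path x y @` `[0, 1].

(* [ordS] is the successor modulo [n], so the last vertex is joined to the
   first one. *)
Definition polygonal_curve (n : nat) (p : 'I_n -> plane) : set plane :=
  \bigcup_i segment (p i) (p (ordS i)).

(* The closed curve is traversed, each point once, by the pairs [(i, t)] with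
   [0 <= t < 1]; simplicity is injectivity of this parametrization. *)
Definition simple_closed (n : nat) (p : 'I_n -> plane) : Prop :=
  forall (i j : 'I_n) (s t : R), 0 <= s < 1 -> 0 <= t < 1 ->
    affine_path (p i) (p (ordS i)) s = affine_path (p j) (p (ordS j)) t ->
    i = j /\ s = t.

(* The curve together with the bounded components of its complement; for a
   simple curve there is exactly one such component, by the Jordan curve
   theorem. *)
Definition enclosed_region (C : set plane) : set plane :=
  C `|` [set x | ~ C x /\ bounded_set (connected_component (~` C) x)].

Definition simple_polygon (P : set plane) : Prop :=
  exists (n : nat) (p : 'I_n -> plane),
    [/\ (3 <= n)%N, simple_closed p & P = enclosed_region (polygonal_curve p)].

Definition vis (P : set plane) (v : plane) : set plane :=
  [set x | P x /\ segment x v `<=` P].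

Definition discernible (P S T : set plane) : Prop :=
  T `<=` S /\ exists2 v, P v & T = vis P v `&` S.

Definition realizable (m : nat) : Prop :=
  exists P S : set plane,
    [/\ simple_polygon P, S `<=` P, S #= `I_m &
        forall T : set plane, T `<=` S -> discernible P S T].

Definition is_VC_dimension (d : nat) : Prop :=
  realizable d /\ forall m : nat, realizable m -> (m <= d)%N.

End SimplePolygons.

(* Main.v *)
(* Call [P] hole-free if it contains the diagonal [z v] of a quadrilateral
   [z a v b] whose sides lie in [P] whenever [a] and [b] are on different sides
   of the line [z v]. A simple polygon is closed and hole-free, and nothing else
   about it is used.

   Suppose that every subset [T] of the fifteen points is the set seen from some
   [v_T]. The point that sees everything can be moved to a centre [z] that still
   sees all points and, moreover, is seen from every [v] that sees three
   particular ones. Fix a set [O] of three points containing these and consider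
   the [2 ^ 12] sets [T] containing [O], so that [z] sees [v_T]. The line from [z]
   to [v_T] splits the points into two sides, and at most 35 splittings occur.

   Consider the sets [T] with one given splitting. If [i] and [j] are on the same
   side and [j] follows [i] around [z], then a viewpoint seeing [i] but not [j]
   follows every viewpoint seeing [j] but not [i]. Hence no three points on one
   side are shattered, and a pair is shattered on the left (on the right) for at
   most one splitting. By Pajor's lemma there are at most as many [T] as
   shattered sets, that is, at most [(1 + a + p) * (1 + b + q)], where [a], [b]
   count the points outside [O] and [p], [q] the shattered pairs on the two sides;
   as [a + b = 12], this is at most [49 + 15 * (p + q)]. In total,
   [4096 <= 35 * 49 + 15 * (66 + 66) = 3695]. *)

Require Import Defs.
From mathcomp Require Import all_boot all_order all_algebra.
From mathcomp Require Import all_classical all_reals all_analysis.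
From mathcomp Require Import ring lra zify.

Set Implicit Arguments.
Unset Strict Implicit.
Unset Printing Implicit Defensive.

Import Order.TTheory GRing.Theory Num.Theory.
Import numFieldNormedType.Exports.

Local Open Scope classical_set_scope.
Local Open Scope card_scope.
Local Open Scope ring_scope.

(** * Simple polygons are hole-free *)

Section Polygon.
Variable R : realType.
Local Notation plane := (R * R)%type.
Implicit Types (P C : set plane) (x y z : plane).

Lemma affine_pathE x y (t : R) :
  affine_path x y t =
  ((1 - t) * x.1 + t * y.1, (1 - t) * x.2 + t * y.2).
Proof. by []. Qed.

Lemma plane_eq x y : x.1 = y.1 -> x.2 = y.2 -> x = y.
Proof. by case: x y => [a b] [c d] /= -> ->. Qed.

(* If [x] were not enclosed, its component in the complement of [C] could not
   cross the zero set of [F], and would therefore be bounded. *)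
Lemma enclosed_region_hole C x (F : plane -> R) :
  continuous F -> 0 < F x ->
  (forall y, F y = 0 -> enclosed_region C y) ->
  bounded_set [set y | 0 < F y] -> enclosed_region C x.
Proof.
move=> Fc Fx F0 Fb; apply: contrapT => Px.
have Cx : (~` C) x by move=> Cx; apply: Px; left.
set A := connected_component (~` C) x.
have Ax : A x by exact: connected_component_refl.
have AF y : A y -> F y <> 0.
  move=> Ay /F0[Cy|[Cy by_]].
    exact: (connected_component_sub Ay).
  by apply: Px; right; split => //; rewrite (same_connected_component Ay).
have /connected_intervalP Fi : connected (F @` A).
  apply: connected_continuous_connected; first exact: component_connected.
  exact: continuous_subspaceT.
have Apos : A `<=` [set y | 0 < F y].
  move=> y Ay /=; rewrite ltNge; apply/negP => Fy.
  have [w Aw Fw] : (F @` A) 0.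
    by apply: (Fi (F y) (F x)); [exists y|exists x|rewrite Fy ltW].
  exact: (AF w Aw).
apply: Px; right; split => //.
by apply: sub_boundedr Fb => Q /= h y Ay; apply: h; exact: Apos.
Qed.

Lemma closed_segment (x y : plane) : closed (segment x y).
Proof.
apply: compact_closed; first exact: norm_hausdorff.
apply: continuous_compact; last exact: segment_compact.
apply: continuous_subspaceT => t.
apply: cvgD.
  by apply: cvgZr_tmp; apply: cvgB; [exact: cvg_cst|exact: cvg_id].
by apply: cvgZr_tmp; exact: cvg_id.
Qed.

Lemma closed_polygonal_curve n (p : 'I_n -> plane) : closed (polygonal_curve p).
Proof.
apply: closed_bigcup => [|i _]; first exact: finite_finset.
exact: closed_segment.
Qed.

Lemma connected_segment (x y : plane) : connected (segment x y).
Proof.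
apply: connected_continuous_connected; first exact: segment_connected.
apply: continuous_subspaceT => t.
apply: cvgD.
  by apply: cvgZr_tmp; apply: cvgB; [exact: cvg_cst|exact: cvg_id].
by apply: cvgZr_tmp; exact: cvg_id.
Qed.

(** A point outside the region has a ball around it that misses [C]. The ball lies in the component
    of its centre, which is not bounded, so the whole ball is outside. *)
Lemma closed_enclosed_region C : closed C -> closed (enclosed_region C).
Proof.
move=> Ccl; rewrite -[enclosed_region C]setCK; apply: open_closedC.
rewrite openE => x Px.
have Cx : (~` C) x by move=> Cx; apply: Px; left.
have /nbhs_ballP[e /= e0 eC] : nbhs x (~` C).
  by apply: open_nbhs_nbhs; split => //; exact: closed_openC.
have xA y : ball x e y -> connected_component (~` C) x y.
  move=> xy; exists (segment x y); last first.
    by exists 1; [rewrite /= in_itv /= lexx ler01|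
                  rewrite affine_pathE subrr !mul0r !mul1r !add0r; case: (y)].
  split; last exact: connected_segment.
    by exists 0; [rewrite /= in_itv /= lexx ler01|
                  rewrite affine_pathE subr0 !mul0r !mul1r !addr0; case: (x)].
  move=> _ [t t01 <-]; move: t01; rewrite /= in_itv /= => /andP[t0 t1].
  apply: eC.
  move: xy; rewrite -!ball_normE /= => xy.
  have -> : x - affine_path x y t = t *: (x - y).
    by apply: plane_eq; rewrite /= /GRing.scale /=; ring.
  by rewrite normrZ ger0_norm// (le_lt_trans _ xy)// ler_piMl.
apply/nbhs_ballP; exists e => //= y xy [Cy|[Cy yb]]; first exact: (eC _ xy).
apply: Px; right; split => //.
by rewrite (same_connected_component (xA _ xy)).
Qed.

Definition see P x y := forall t : R, 0 <= t <= 1 -> P (affine_path x y t).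

Lemma see_segment P x y : segment x y `<=` P <-> see P x y.
Proof.
split=> [h t t01|h _ [t t01 <-]].
  by apply: h; exists t => //=; rewrite in_itv.
by apply: h; move: t01 => /=; rewrite in_itv.
Qed.

(** The cross product: positive if [y] lies to the left of the ray from [0] through [x], zero if
    [x], [y] and [0] are collinear. *)
Definition cr x y : R := x.1 * y.2 - x.2 * y.1.

Definition hole_free P := forall z v a b,
  see P z a -> see P a v -> see P v b -> see P b z ->
  0 < cr (v - z) (a - z) -> cr (v - z) (b - z) < 0 -> see P z v.

Lemma continuous_coord (c1 c2 c3 : R) :
  continuous (fun p : plane => c1 * p.1 + c2 * p.2 + c3).
Proof.
move=> p; apply: cvgD; last exact: cvg_cst.
apply: cvgD; apply: cvgM; try exact: cvg_cst; [exact: cvg_fst|exact: cvg_snd].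
Qed.

(** The four sides of the quadrilateral take the role of the zero set in [enclosed_region_hole]: a
    continuous, piecewise affine function is positive exactly inside and vanishes only on the
    sides. *)
Lemma hole_free_enclosed_region C : hole_free (enclosed_region C).
Proof.
move=> z v a b za av vb bz.
set d := cr (v - z) (a - z); set d' := cr (v - z) (b - z) => d0 d'0 t t01.
have dn0 : d != 0 by rewrite gt_eqF.
have d'n0 : d' != 0 by rewrite lt_eqF.
(* The two ends of the diagonal are treated apart, since the function [F] below vanishes there. *)
have [t0|t0] := eqVneq t 0.
  have := za 0; rewrite t0 !affine_pathE !subr0 !mul0r.
  by apply; rewrite lexx ler01.
have [t1|t1] := eqVneq t 1.
  have := vb 0; rewrite t1 !affine_pathE !subr0 subrr !mul0r !addr0 !add0r.
  by apply; rewrite lexx ler01.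
pose l (p : plane) := cr (v - z) (p - z).
pose ln p := Num.min (l p) 0.
(* [be] is the barycentric coordinate along [v] in the triangle [z, v, a] on one
   side of the line [z, v] and in the triangle [z, v, b] on the other; [al] is
   the one along [z], so [F] is positive exactly inside the quadrilateral. *)
pose be p := cr (p - z) (a - z) / d + ln p * (cr (a - z) (b - z) / (d * d')).
pose al p := 1 - be p - (l p - ln p) / d - ln p / d'.
pose F p := Num.min (al p) (be p).
have cl : continuous l.
  have -> : l = fun p : plane => (- (v - z).2) * p.1 + (v - z).1 * p.2 +
     ((v - z).2 * z.1 - (v - z).1 * z.2).
    by apply/funext => p; rewrite /l /cr /=; ring.
  by move=> p; apply: continuous_coord.
have cca : continuous (fun p : plane => cr (p - z) (a - z)).
  have -> : (fun p : plane => cr (p - z) (a - z)) =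
     fun p : plane => (a - z).2 * p.1 + (- (a - z).1) * p.2 +
     ((a - z).1 * z.2 - (a - z).2 * z.1).
    by apply/funext => q; rewrite /cr /=; ring.
  by move=> p; apply: continuous_coord.
have cln : continuous ln.
  by move=> p; apply: continuous_min; [exact: cl|exact: cst_continuous].
have cbe : continuous be.
  move=> p; apply: cvgD; last by apply: cvgM; [exact: cln|exact: cvg_cst].
  apply: cvgM; last exact: cvg_cst.
  exact: cca.
have cal : continuous al.
  move=> p; apply: cvgB; last by apply: cvgM; [exact: cln|exact: cvg_cst].
  apply: cvgB; last first.
    by apply: cvgM; [apply: cvgB; [exact: cl|exact: cln]|exact: cvg_cst].
  by apply: cvgB; [exact: cvg_cst|exact: cbe].
(* By Cramer's rule, [p - z] is expanded in [v - z] and [a - z] on the side of [a], and below in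
   [v - z] and [b - z] on the side of [b]. *)
have pos_case p : 0 <= l p -> [/\ ln p = 0,
    p.1 = z.1 + be p * (v - z).1 + l p / d * (a - z).1 &
    p.2 = z.2 + be p * (v - z).2 + l p / d * (a - z).2].
  move=> lp; have -> : ln p = 0 by apply/min_idPr.
  split => //; apply: (mulfI dn0); rewrite /be /ln (min_idPr _)// mul0r addr0.
    have -> : d * (z.1 + cr (p - z) (a - z) / d * (v - z).1 + l p / d * (a - z).1)
      = d * z.1 + cr (p - z) (a - z) * (v - z).1 + l p * (a - z).1 by field.
    by rewrite /d /l /cr /=; ring.
  have -> : d * (z.2 + cr (p - z) (a - z) / d * (v - z).2 + l p / d * (a - z).2)
      = d * z.2 + cr (p - z) (a - z) * (v - z).2 + l p * (a - z).2 by field.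
  by rewrite /d /l /cr /=; ring.
have neg_case p : l p <= 0 -> [/\ ln p = l p,
    p.1 = z.1 + be p * (v - z).1 + l p / d' * (b - z).1 &
    p.2 = z.2 + be p * (v - z).2 + l p / d' * (b - z).2].
  move=> lp; have -> : ln p = l p by apply/min_idPl.
  have -> : be p = cr (p - z) (b - z) / d'.
    rewrite /be /ln (min_idPl _)//; apply: (mulfI (mulf_neq0 dn0 d'n0)).
    have -> : d * d' * (cr (p - z) (a - z) / d +
       l p * (cr (a - z) (b - z) / (d * d'))) =
       d' * cr (p - z) (a - z) + l p * cr (a - z) (b - z).
      by field; rewrite dn0 d'n0.
    have -> : d * d' * (cr (p - z) (b - z) / d') = d * cr (p - z) (b - z).
      by field.
    by rewrite /d /d' /l /cr /=; ring.
  split => //; apply: (mulfI d'n0).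
    have -> : d' * (z.1 + cr (p - z) (b - z) / d' * (v - z).1 + l p / d' * (b - z).1)
      = d' * z.1 + cr (p - z) (b - z) * (v - z).1 + l p * (b - z).1 by field.
    by rewrite /d' /l /cr /=; ring.
  have -> : d' * (z.2 + cr (p - z) (b - z) / d' * (v - z).2 + l p / d' * (b - z).2)
      = d' * z.2 + cr (p - z) (b - z) * (v - z).2 + l p * (b - z).2 by field.
  by rewrite /d' /l /cr /=; ring.
apply: (@enclosed_region_hole C _ F).
- by move=> p; apply: continuous_min; [exact: cal|exact: cbe].
- have l0 : l (affine_path z v t) = 0 by rewrite /l affine_pathE /cr /=; ring.
  have ln0 : ln (affine_path z v t) = 0 by rewrite /ln l0 minxx.
  have bet : be (affine_path z v t) = t.
    rewrite /be ln0 mul0r addr0; apply: (mulIf dn0); rewrite mulfVK//.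
    by rewrite /d affine_pathE /cr /=; ring.
  rewrite /F lt_min /al bet l0 ln0 subrr !mul0r !subr0.
  move/andP: t01 => [t_ge t_le].
  by rewrite subr_gt0 !lt_neqAle t_ge t_le t1 eq_sym t0.
- move=> p Fp0.
  have : (al p = 0 /\ 0 <= be p) \/ (be p = 0 /\ 0 <= al p).
    move: Fp0; rewrite /F; case: (leP (al p) (be p)) => h e.
      by left; split => //; rewrite -e.
    by right; split => //; rewrite -e ltW.
  case: (leP 0 (l p)) => lp.
    have [lnp p1 p2] := pos_case _ lp.
    have ld : 0 <= l p / d by rewrite divr_ge0// ltW.
    rewrite /al lnp subr0 !mul0r subr0.
    case=> -[e1 e2].
      have -> : p = affine_path a v (be p).
        have e3 : l p / d = 1 - be p by lra.
        by apply: plane_eq; rewrite ?p1 ?p2 e3 /=; rewrite /GRing.scale /=; ring.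
      by apply: av; rewrite e2 /=; lra.
    have -> : p = affine_path z a (l p / d).
      by apply: plane_eq; rewrite ?p1 ?p2 e1 /=; rewrite /GRing.scale /=; ring.
    by apply: za; rewrite ld /=; lra.
  have [lnp p1 p2] := neg_case _ (ltW lp).
  have ld : 0 <= l p / d' by rewrite ltW// nmulr_rgt0// invr_lt0.
  rewrite /al lnp subrr !mul0r subr0.
  case=> -[e1 e2].
    have -> : p = affine_path v b (l p / d').
      have e3 : be p = 1 - l p / d' by lra.
      apply: plane_eq; rewrite ?p1 ?p2 e3 /=; rewrite /GRing.scale /=; ring.
    by apply: vb; rewrite ld /=; lra.
  have -> : p = affine_path b z (1 - l p / d').
    by apply: plane_eq; rewrite ?p1 ?p2 e1 /=; rewrite /GRing.scale /=; ring.
  by apply: bz; apply/andP; split; lra.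
- pose M := `|z.1| + `|z.2| + `|(v - z).1| + `|(v - z).2| +
     `|(a - z).1| + `|(a - z).2| + `|(b - z).1| + `|(b - z).2|.
  exists M; split; first exact: num_real.
  move=> M' MM' p /=; rewrite /F lt_min => /andP[alp bep].
  apply: le_trans (ltW MM').
  have key (be' ga : R) (z0 v0 a0 : R) : 0 <= be' <= 1 -> 0 <= ga <= 1 ->
      `|z0 + be' * v0 + ga * a0| <= `|z0| + `|v0| + `|a0|.
    move=> /andP[b1 b2] /andP[g1 g2].
    rewrite (le_trans (ler_normD _ _))// lerD//; last first.
      by rewrite normrM ger0_norm// ler_piMl.
    by rewrite (le_trans (ler_normD _ _))// lerD// normrM ger0_norm// ler_piMl.
  have nn (x : R) : 0 <= `|x| by [].
  move: alp; rewrite /al; case: (leP 0 (l p)) => lp.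
    have [lnp p1 p2] := pos_case _ lp.
    have ld : 0 <= l p / d by rewrite divr_ge0// ltW.
    rewrite lnp subr0 !mul0r subr0 => alp.
    have k1 := key (be p) (l p / d) z.1 (v - z).1 (a - z).1.
    have k2 := key (be p) (l p / d) z.2 (v - z).2 (a - z).2.
    rewrite [`|p|]/Num.norm /= ge_max p1 p2 /M.
    have b1 : 0 <= be p <= 1 by apply/andP; split; lra.
    have g1 : 0 <= l p / d <= 1 by apply/andP; split; lra.
    apply/andP; split.
      apply: (le_trans (k1 b1 g1)).
      move: (nn z.2) (nn (v - z).2) (nn (a - z).2) (nn (b - z).1) (nn (b - z).2).
      by lra.
    apply: (le_trans (k2 b1 g1)).
    move: (nn z.1) (nn (v - z).1) (nn (a - z).1) (nn (b - z).1) (nn (b - z).2).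
    by lra.
  have [lnp p1 p2] := neg_case _ (ltW lp).
  have ld : 0 <= l p / d' by rewrite ltW// nmulr_rgt0// invr_lt0.
  rewrite lnp subrr !mul0r subr0 => alp.
  have k1 := key (be p) (l p / d') z.1 (v - z).1 (b - z).1.
  have k2 := key (be p) (l p / d') z.2 (v - z).2 (b - z).2.
  rewrite [`|p|]/Num.norm /= ge_max p1 p2 /M.
  have b1 : 0 <= be p <= 1 by apply/andP; split; lra.
  have g1 : 0 <= l p / d' <= 1 by apply/andP; split; lra.
  apply/andP; split.
    apply: (le_trans (k1 b1 g1)).
    move: (nn z.2) (nn (v - z).2) (nn (b - z).2) (nn (a - z).1) (nn (a - z).2).
    by lra.
  apply: (le_trans (k2 b1 g1)).
  move: (nn z.1) (nn (v - z).1) (nn (b - z).1) (nn (a - z).1) (nn (a - z).2).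
  by lra.
Qed.

End Polygon.

(** * The circular order of viewpoints *)

Section Visibility.
Variable R : realType.
Local Notation plane := (R * R)%type.
Implicit Types (P C : set plane) (x y z : plane).

Lemma see_left P x y : see P x y -> P x.
Proof.
move=> /(_ 0); rewrite affine_pathE subr0 !mul0r !mul1r !addr0.
by case: x => a b; apply; rewrite lexx ler01.
Qed.

Lemma see_sym P x y : see P x y -> see P y x.
Proof.
move=> xy t t01; have -> : affine_path y x t = affine_path x y (1 - t).
  by apply: plane_eq; rewrite !affine_pathE /=; ring.
by apply: xy; lra.
Qed.

Lemma see_sub P x y s t : see P x y -> 0 <= s <= 1 -> 0 <= t <= 1 ->
  see P (affine_path x y s) (affine_path x y t).
Proof.
move=> xy s01 t01 r r01.
have -> : affine_path (affine_path x y s) (affine_path x y t) r =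
    affine_path x y ((1 - r) * s + r * t).
  by apply: plane_eq; rewrite !affine_pathE /=; ring.
by apply: xy; nra.
Qed.

Lemma affine_path0 x y : affine_path x y 0 = x.
Proof. by apply: plane_eq; rewrite affine_pathE /=; ring. Qed.

Lemma affine_path1 x y : affine_path x y 1 = y.
Proof. by apply: plane_eq; rewrite affine_pathE /=; ring. Qed.

Lemma see_subl P x y t : see P x y -> 0 <= t <= 1 -> see P x (affine_path x y t).
Proof.
by move=> xy t01; rewrite -{1}(affine_path0 x y); apply: see_sub => //; lra.
Qed.

Lemma see_subr P x y t : see P x y -> 0 <= t <= 1 -> see P (affine_path x y t) y.
Proof.
by move=> xy t01; rewrite -{2}(affine_path1 x y); apply: see_sub => //; lra.
Qed.

Section Star.
Variable P : set plane.
Hypothesis Phf : hole_free P.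

(** The point lies on a segment from [x] to a point of the side [y w]. That segment is the diagonal
    of a quadrilateral with a straight angle there. *)
Lemma triangle_sub x y w s t : see P x y -> see P y w -> see P w x ->
  0 < cr (y - x) (w - x) -> 0 <= s -> 0 <= t -> s + t <= 1 ->
  P (x + s *: (y - x) + t *: (w - x)).
Proof.
move=> xy yw wx d0 s0 t0 st1.
have [ss|ss] := eqVneq s 0.
  have -> : x + s *: (y - x) + t *: (w - x) = affine_path w x (1 - t).
    by apply: plane_eq; rewrite affine_pathE ss /= /GRing.scale /=; ring.
  by apply: wx; lra.
have [tt|tt] := eqVneq t 0.
  have -> : x + s *: (y - x) + t *: (w - x) = affine_path x y s.
    by apply: plane_eq; rewrite affine_pathE tt /= /GRing.scale /=; ring.
  by apply: xy; lra.
have sp : 0 < s by rewrite lt_neqAle eq_sym ss.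
have tp : 0 < t by rewrite lt_neqAle eq_sym tt.
have stp : s + t != 0 by rewrite gt_eqF// addr_gt0.
set r := t / (s + t).
have r01 : 0 < r < 1.
  by rewrite /r divr_gt0 ?addr_gt0//= ltr_pdivrMr ?addr_gt0// mul1r ltrDr.
have -> : x + s *: (y - x) + t *: (w - x) =
    affine_path x (affine_path y w r) (s + t).
  apply: plane_eq; rewrite !affine_pathE /= /GRing.scale /= /r; field => //.
apply: (Phf (a := w) (b := y)).
- exact: see_sym.
- by apply: see_sym; apply: see_subr => //; lra.
- by apply: see_sym; apply: see_subl => //; lra.
- exact: see_sym.
- have -> : cr (affine_path y w r - x) (w - x) = (1 - r) * cr (y - x) (w - x).
    by rewrite affine_pathE /cr /=; ring.
  by rewrite mulr_gt0//; lra.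
- have -> : cr (affine_path y w r - x) (y - x) = - (r * cr (y - x) (w - x)).
    by rewrite affine_pathE /cr /=; ring.
  by rewrite oppr_lt0 mulr_gt0//; lra.
- by apply/andP; split => //; rewrite addr_ge0.
Qed.

(** For [0 < cr e w], the closed triangle with corners [0], [e], [w], in barycentric coordinates
    multiplied by [cr e w]. *)
Definition in_triangle (e w p : plane) := [/\ 0 <= cr e p, 0 <= cr p w &
  cr e p + cr p w <= cr e w].

(** The triangle is convex, and it is contained in [P] by [triangle_sub]. *)
Lemma triangle_see e w p q : see P 0 e -> see P 0 w -> see P e w ->
  0 < cr e w -> in_triangle e w p -> in_triangle e w q -> see P p q.
Proof.
move=> oe ow ew d0 [p1 p2 p3] [q1 q2 q3] t /andP[t0 t1].
have dn : cr e w != 0 by rewrite gt_eqF.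
set x := affine_path p q t.
have x1 : 0 <= cr e x.
  have -> : cr e x = (1 - t) * cr e p + t * cr e q.
    by rewrite /x affine_pathE /cr /=; ring.
  by rewrite addr_ge0// mulr_ge0//; lra.
have x2 : 0 <= cr x w.
  have -> : cr x w = (1 - t) * cr p w + t * cr q w.
    by rewrite /x affine_pathE /cr /=; ring.
  by rewrite addr_ge0// mulr_ge0//; lra.
have x3 : cr e x + cr x w <= cr e w.
  have -> : cr e x + cr x w =
     (1 - t) * (cr e p + cr p w) + t * (cr e q + cr q w).
    by rewrite /x affine_pathE /cr /=; ring.
  by nra.
have -> : x = 0 + (cr x w / cr e w) *: (e - 0) + (cr e x / cr e w) *: (w - 0).
  rewrite !subr0 add0r; apply: plane_eq; apply: (mulfI dn).
    have -> : ((cr x w / cr e w) *: e + (cr e x / cr e w) *: w).1 =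
       (cr x w * e.1 + cr e x * w.1) / cr e w.
      by rewrite /= /GRing.scale /=; field.
    by rewrite mulrC mulrCA divff// mulr1 /cr; ring.
  have -> : ((cr x w / cr e w) *: e + (cr e x / cr e w) *: w).2 =
     (cr x w * e.2 + cr e x * w.2) / cr e w.
    by rewrite /= /GRing.scale /=; field.
  by rewrite mulrC mulrCA divff// mulr1 /cr; ring.
apply: triangle_sub => //; rewrite ?subr0//.
- exact: see_sym.
- by rewrite divr_ge0// ltW.
- by rewrite divr_ge0// ltW.
- by rewrite -mulrDl ler_pdivrMr// mul1r addrC.
Qed.

(** On a line through [0], the segment from [a] to [b] is covered by the segments from [0] to [a]
    and from [0] to [b]. *)
Lemma see_parallel a b : see P 0 a -> see P 0 b -> cr a b = 0 -> see P a b.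
Proof.
move=> oa ob ab t /andP[t0 t1].
have seg c (k : R) : see P 0 c -> 0 <= k <= 1 -> P (k * c.1, k * c.2).
  move=> oc k01; have := oc k k01; rewrite affine_pathE /=.
  by rewrite !mulr0 !add0r.
rewrite affine_pathE.
have [n0|n0] := eqVneq (a.1 ^+ 2 + a.2 ^+ 2) 0.
  have /eqP a10 : a.1 == 0.
    by rewrite -sqrf_eq0; apply/eqP; move: (sqr_ge0 a.1) (sqr_ge0 a.2) n0; lra.
  have /eqP a20 : a.2 == 0.
    by rewrite -sqrf_eq0; apply/eqP; move: (sqr_ge0 a.1) (sqr_ge0 a.2) n0; lra.
  by rewrite a10 a20 !mulr0 !add0r; apply: seg => //; rewrite t0.
set m := (a.1 * b.1 + a.2 * b.2) / (a.1 ^+ 2 + a.2 ^+ 2).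
have b1 : b.1 = m * a.1.
  apply: (mulIf n0); rewrite /m mulrAC divfK//.
  have e : (a.1 * b.1 + a.2 * b.2) * a.1 =
     b.1 * (a.1 ^+ 2 + a.2 ^+ 2) + a.2 * cr a b by rewrite /cr; ring.
  by rewrite e ab mulr0 addr0.
have b2 : b.2 = m * a.2.
  apply: (mulIf n0); rewrite /m mulrAC divfK//.
  have e : (a.1 * b.1 + a.2 * b.2) * a.2 =
     b.2 * (a.1 ^+ 2 + a.2 ^+ 2) - a.1 * cr a b by rewrite /cr; ring.
  by rewrite e ab mulr0 subr0.
(* As [b = m a], the point in question is [k a]. It lies on the segment from [0] to [a] if
   [0 <= k <= 1], and on the one from [0] to [b] otherwise. *)
set k := 1 - t + t * m.
have pa : ((1 - t) * a.1 + t * b.1, (1 - t) * a.2 + t * b.2) =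
    (k * a.1, k * a.2).
  by rewrite b1 b2 /k; congr pair; ring.
have pb : m != 0 -> ((1 - t) * a.1 + t * b.1, (1 - t) * a.2 + t * b.2) =
    (k / m * b.1, k / m * b.2).
  by move=> m0; rewrite pa b1 b2; congr pair; field.
have [k0|k0] := ltP k 0.
  have m0 : m < 0.
    rewrite ltNge; apply/negP => m0; have := mulr_ge0 t0 m0.
    by rewrite /k in k0; lra.
  rewrite pb ?lt_eqF//; apply: seg => //; apply/andP; split.
    by rewrite nmulr_lge0 ?ltW// invr_lt0.
  rewrite ler_ndivrMr// mul1r /k -subr_ge0.
  have -> : 1 - t + t * m - m = (1 - t) * (1 - m) by ring.
  by rewrite mulr_ge0//; lra.
have [k1|k1] := ltP 1 k.
  have m1 : 1 < m.
    rewrite ltNge; apply/negP => m1.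
    have : 0 <= t * (1 - m) by rewrite mulr_ge0//; lra.
    by rewrite /k in k1; lra.
  have m0 : 0 < m by lra.
  rewrite pb ?gt_eqF//; apply: seg => //; apply/andP; split.
    by rewrite divr_ge0// ltW.
  rewrite ler_pdivrMr// mul1r /k -subr_ge0.
  have -> : m - (1 - t + t * m) = (1 - t) * (m - 1) by ring.
  by rewrite mulr_ge0//; lra.
by rewrite pa; apply: seg => //; rewrite k0.
Qed.

(** Around [0] the order is [i], [j], [w], [v]. If [j] lies in the triangle [0], [i], [w], or [w] in
    the triangle [0], [j], [v], then [j] sees [w]. Otherwise the segments [i w] and [j v] cross, and
    [i v] is a diagonal of the quadrilateral formed by [i], [0], [v] and the crossing point. *)
Lemma see_order i j v w :
  see P 0 i -> see P 0 j -> see P 0 v -> see P 0 w ->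
  0 < cr i j -> 0 < cr j w -> 0 <= cr w v ->
  0 < cr i v -> 0 < cr i w -> 0 < cr j v ->
  see P i w -> see P j v -> see P j w \/ see P i v.
Proof.
move=> oi oj ov ow ij jw wv iv iw jv siw sjv.
have pl : cr i w * cr j v = cr i j * cr w v + cr i v * cr j w.
  by rewrite /cr; ring.
have cr0 (x : plane) : cr x x = 0 by rewrite /cr; ring.
have [c1|c1] := leP (cr i j + cr j w) (cr i w).
  left; apply: (triangle_see oi ow siw iw); split;
    by rewrite ?cr0 ?addr0 // ltW.
have [c2|c2] := leP (cr j w + cr w v) (cr j v).
  left; apply: (triangle_see oj ov sjv jv); split;
    by rewrite ?cr0 ?add0r // ltW.
right.
(* [hi] and [hw] place [i] and [w] relative to the line [j v], while [fj] and [fv] place [j] and [v]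
   relative to the line [i w]. Their opposite signs make the segments cross, at the parameters
   [hi / D] and [- fj / D]. *)
pose D := cr (v - j) (i - w).
pose hi := cr (v - j) (i - j); pose hw := cr (v - j) (w - j).
pose fj := cr (w - i) (j - i); pose fv := cr (w - i) (v - i).
have hi0 : 0 < hi.
  have e : hi * cr j w = cr i j * (cr j w + cr w v - cr j v)
      + cr j v * (cr i j + cr j w - cr i w).
    have -> : hi = cr i j + cr j v - cr i v by rewrite /hi /cr /=; ring.
    by rewrite /cr; ring.
  rewrite -(pmulr_lgt0 _ jw) e addr_gt0// mulr_gt0//; lra.
have hw0 : hw < 0.
  have -> : hw = cr j v - cr w v - cr j w by rewrite /hw /cr /=; ring.
  by lra.
have fv0 : 0 < fv.
  have e : fv * cr j w = cr w v * (cr i j + cr j w - cr i w)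
      + cr i w * (cr j w + cr w v - cr j v).
    have -> : fv = cr w v + cr i w - cr i v by rewrite /fv /cr /=; ring.
    by rewrite /cr; ring.
  rewrite -(pmulr_lgt0 _ jw) e ltr_wpDl// ?mulr_gt0 ?mulr_ge0//; lra.
have fj0 : fj < 0.
  have -> : fj = cr i w - cr i j - cr j w by rewrite /fj /cr /=; ring.
  by lra.
have D1 : D = hi - hw by rewrite /D /hi /hw /cr /=; ring.
have D2 : D = fv - fj by rewrite /D /fv /fj /cr /=; ring.
have D0 : 0 < D by rewrite D1; lra.
have Dn : D != 0 by rewrite gt_eqF.
have m01 : 0 < hi / D < 1.
  by rewrite divr_gt0//= ltr_pdivrMr// mul1r D1; lra.
have t01 : 0 <= - fj / D <= 1.
  by rewrite divr_ge0 ?ltW ?oppr_gt0//= ltr_pdivrMr// mul1r D2; lra.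
have xE : affine_path i w (hi / D) = affine_path j v (- fj / D).
  have Di : D = cr (v - j) (i - w) by [].
  apply: plane_eq; rewrite !affine_pathE /=; apply: (mulfI Dn).
    have -> : D * ((1 - hi / D) * i.1 + hi / D * w.1) =
        (D - hi) * i.1 + hi * w.1 by field.
    have -> : D * ((1 - - fj / D) * j.1 + - fj / D * v.1) =
        (D + fj) * j.1 - fj * v.1 by field.
    by rewrite /D /hi /fj /cr /=; ring.
  have -> : D * ((1 - hi / D) * i.2 + hi / D * w.2) =
      (D - hi) * i.2 + hi * w.2 by field.
  have -> : D * ((1 - - fj / D) * j.2 + - fj / D * v.2) =
      (D + fj) * j.2 - fj * v.2 by field.
  by rewrite /D /hi /fj /cr /=; ring.
apply: (Phf (a := 0) (b := affine_path i w (hi / D))).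
- exact: see_sym.
- exact: ov.
- by rewrite xE; apply: see_sym; apply: see_subr.
- by apply: see_sym; apply: see_subl => //; lra.
- by have -> : cr (v - i) (0 - i) = cr i v by rewrite /cr /=; ring.
- have -> : cr (v - i) (affine_path i w (hi / D) - i) = - (hi / D * fv).
    by rewrite affine_pathE /fv /cr /=; ring.
  by rewrite oppr_lt0 mulr_gt0//; lra.
Qed.

(** Otherwise [w] does not follow [v], and [see_order] gives a contradiction. Its strict hypotheses
    hold because a hidden pair is not collinear with [0], by [see_parallel], and because the
    Pluecker relation [pl] makes the remaining two cross products positive. *)
Lemma pair_order i j v w :
  see P 0 i -> see P 0 j -> see P 0 v -> see P 0 w -> 0 < cr i j ->
  0 <= cr i v -> 0 <= cr j v -> 0 <= cr i w -> 0 <= cr j w ->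
  see P j v -> ~ see P i v -> see P i w -> ~ see P j w -> 0 < cr v w.
Proof.
move=> oi oj ov ow ij iv jv iw jw sjv siv siw sjw; rewrite ltNge; apply/negP => vw.
have wv : 0 <= cr w v.
  have -> : cr w v = - cr v w by rewrite /cr; ring.
  by rewrite oppr_ge0.
have iv' : 0 < cr i v.
  by rewrite lt_neqAle iv andbT; apply/eqP => e; apply: siv; apply: see_parallel.
have jw' : 0 < cr j w.
  by rewrite lt_neqAle jw andbT; apply/eqP => e; apply: sjw; apply: see_parallel.
have pl : cr i w * cr j v = cr i j * cr w v + cr i v * cr j w.
  by rewrite /cr; ring.
have p0 : 0 < cr i w * cr j v.
  by rewrite pl ltr_wpDl ?mulr_gt0 ?mulr_ge0// ltW.
have iw' : 0 < cr i w.
  by rewrite lt_neqAle iw andbT; apply/eqP => e; move: p0; rewrite -e mul0r ltxx.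
have jv' : 0 < cr j v.
  by rewrite lt_neqAle jv andbT; apply/eqP => e; move: p0; rewrite -e mulr0 ltxx.
by have [] := see_order oi oj ov ow ij jw' wv iv' iw' jv' siw sjv.
Qed.

(** The conditions on [v0] say that [j] lies on the segment from [0] to [i], hence in the triangle
    [0], [i], [v]. *)
Lemma parallel_pair i j v0 : see P 0 i -> see P 0 j -> cr i j = 0 ->
  0 < cr j v0 -> cr j v0 <= cr i v0 ->
  forall v, see P 0 v -> 0 <= cr i v -> see P i v -> see P j v.
Proof.
move=> oi oj ij jv0 ijv v ov iv siv.
have [e|n] := eqVneq (cr j v) 0; first exact: see_parallel.
have iv0 : 0 < cr i v0 by exact: lt_le_trans ijv.
have pl : cr j v * cr i v0 = cr i v * cr j v0.
  have : cr i j * cr v v0 = 0 by rewrite ij mul0r.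
  by rewrite /cr; lra.
have jv : 0 < cr j v.
  by rewrite lt_neqAle eq_sym n -(pmulr_lge0 _ iv0) pl mulr_ge0// ltW.
have iv' : 0 < cr i v by rewrite -(pmulr_lgt0 _ jv0) -pl mulr_gt0.
apply: (triangle_see oi ov siv iv'); split; rewrite ?ij ?add0r//.
- exact: ltW.
- by rewrite -(ler_pM2r iv0) pl ler_pM2l.
- by rewrite /cr mulrC subrr.
- have -> : cr v v = 0 by rewrite /cr; ring.
  by rewrite addr0.
Qed.

End Star.
End Visibility.

(** * The centre *)

Section Kernel.
Variable R : realType.
Local Notation plane := (R * R)%type.
Implicit Types (P : set plane) (x y z : plane).

Definition translate P z := [set p | P (p + z)].

Lemma see_translate P z x y : see (translate P z) x y <-> see P (x + z) (y + z).
Proof.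
have E t : affine_path x y t + z = affine_path (x + z) (y + z) t.
  by apply: plane_eq; rewrite !affine_pathE /=; ring.
by split=> h t /h; rewrite /translate /= E.
Qed.

Lemma hole_free_translate P z : hole_free P -> hole_free (translate P z).
Proof.
move=> Phf o v a b /see_translate oa /see_translate av /see_translate vb /see_translate bo va0 vb0.
apply/see_translate; apply: (Phf _ _ _ _ oa av vb bo).
  by have -> : cr (v + z - (o + z)) (a + z - (o + z)) = cr (v - o) (a - o)
    by rewrite /cr /=; ring.
by have -> : cr (v + z - (o + z)) (b + z - (o + z)) = cr (v - o) (b - o)
  by rewrite /cr /=; ring.
Qed.

(** This is [see_parallel] with [a] moved to the origin. *)
Lemma see_collinear P a v : see P 0 a -> see P a v -> cr a v = 0 -> see P 0 v.
Proof.
move=> oa av cr0.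
rewrite -[0](subrK a) -[v](subrK a); apply/see_translate; apply: see_parallel.
- by apply/see_translate; rewrite subrK add0r; exact: see_sym.
- by apply/see_translate; rewrite subrK add0r.
- have -> : cr (0 - a) (v - a) = - cr a v by rewrite /cr /=; ring.
  by rewrite cr0 oppr0.
Qed.

Section Star.
Variable P : set plane.
Hypothesis Phf : hole_free P.

(** If [a] and [b] are strictly on different sides of the line from [0] to [v], that segment is a
    diagonal of the quadrilateral [0 a v b]; the degenerate cases are collinear. *)
Lemma see_between a b v : see P 0 a -> see P 0 b -> see P v a -> see P v b ->
  cr v a * cr v b <= 0 -> see P 0 v.
Proof.
move=> oa ob va vb ab.
have cN x y : cr x y = - cr y x by rewrite /cr; ring.
have [a0|an] := eqVneq (cr v a) 0.
  by apply: (see_collinear oa); [exact: see_sym|rewrite cN a0 oppr0].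
have [b0|bn] := eqVneq (cr v b) 0.
  by apply: (see_collinear ob); [exact: see_sym|rewrite cN b0 oppr0].
have hf a' b' : see P 0 a' -> see P 0 b' -> see P v a' -> see P v b' ->
    0 < cr v a' -> cr v b' < 0 -> see P 0 v.
  move=> oa' ob' va' vb' a'0 b'0; apply: (Phf (a := a') (b := b')) => //.
  - exact: see_sym.
  - exact: see_sym.
  - by rewrite !subr0.
  - by rewrite !subr0.
have [ap|ap] := ltP 0 (cr v a).
  apply: (hf a b) => //; rewrite lt_neqAle bn /=.
  by rewrite -(pmulr_rle0 _ ap).
have an' : cr v a < 0 by rewrite lt_neqAle an.
apply: (hf b a) => //; rewrite lt_neqAle eq_sym bn /=.
by rewrite -(nmulr_rle0 _ an').
Qed.

(** As [0] is a convex combination of [a], [b], [c] up to scaling, the three points cannot lie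
    strictly on one side of the line from [0] to [v], so [see_between] applies to two of them. *)
Lemma see_hull a b c (p q r : R) v :
  see P 0 a -> see P 0 b -> see P 0 c -> see P v a -> see P v b -> see P v c ->
  0 <= p -> 0 <= q -> 0 <= r -> 0 < p + q + r ->
  p *: a + q *: b + r *: c = 0 -> see P 0 v.
Proof.
move=> oa ob oc va vb vc p0 q0 r0 pqr e.
have E : p * cr v a + q * cr v b + r * cr v c = 0.
  have -> : p * cr v a + q * cr v b + r * cr v c =
     cr v (p *: a + q *: b + r *: c).
    by rewrite /cr /= /GRing.scale /=; ring.
  by rewrite e /cr /=; ring.
have [ab|ab] := leP (cr v a * cr v b) 0; first exact: (see_between oa ob).
have [bc|bc] := leP (cr v b * cr v c) 0; first exact: (see_between ob oc).
exfalso.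
have z0 (k m : R) : m != 0 -> k * m = 0 -> k = 0.
  by move=> m0 /eqP; rewrite mulf_eq0 (negPf m0) orbF => /eqP.
have [ap|ap] := ltP 0 (cr v a).
  have bp : 0 < cr v b by rewrite -(pmulr_rgt0 _ ap).
  have cp : 0 < cr v c by rewrite -(pmulr_rgt0 _ bp).
  move: (mulr_ge0 p0 (ltW ap)) (mulr_ge0 q0 (ltW bp)) (mulr_ge0 r0 (ltW cp)).
  move=> ea eb ec.
  have p1 : p = 0 by apply: (z0 _ (cr v a)); [rewrite gt_eqF|lra].
  have q1 : q = 0 by apply: (z0 _ (cr v b)); [rewrite gt_eqF|lra].
  have r1 : r = 0 by apply: (z0 _ (cr v c)); [rewrite gt_eqF|lra].
  by move: pqr; rewrite p1 q1 r1; lra.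
have ap' : cr v a < 0.
  rewrite lt_neqAle ap andbT; apply/eqP => e0.
  by move: ab; rewrite e0 mul0r ltxx.
have bp : cr v b < 0 by rewrite -(nmulr_rgt0 _ ap').
have cp : cr v c < 0 by rewrite -(nmulr_rgt0 _ bp).
move: (mulr_ge0_le0 p0 (ltW ap')) (mulr_ge0_le0 q0 (ltW bp))
  (mulr_ge0_le0 r0 (ltW cp)) => ea eb ec.
have p1 : p = 0 by apply: (z0 _ (cr v a)); [rewrite lt_eqF|lra].
have q1 : q = 0 by apply: (z0 _ (cr v b)); [rewrite lt_eqF|lra].
have r1 : r = 0 by apply: (z0 _ (cr v c)); [rewrite lt_eqF|lra].
by move: pqr; rewrite p1 q1 r1; lra.
Qed.

(* [a] is hidden, right at the centre [0], from the way towards [b]. *)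
Definition blocked (a b : plane) := forall t : R, 0 < t <= 1 -> ~ see P a (t *: b).

Lemma see_scale a (t : R) : see P 0 a -> 0 <= t <= 1 -> see P 0 (t *: a).
Proof.
move=> oa t01; have -> : t *: a = affine_path 0 a t.
  by rewrite /affine_path scaler0 add0r.
exact: see_subl.
Qed.

(** The inequality says that [s *: b] does not lie beyond the segment from [a] to [t *: c], so it is
    in the triangle [0], [a], [t *: c]. The next lemma is the mirror image. *)
Lemma triangle_seel a b c (s t : R) : see P 0 a -> see P 0 b -> see P 0 c ->
  0 < t <= 1 -> 0 < s <= 1 -> 0 < cr a b -> 0 <= cr b c -> 0 < cr a c ->
  s * (cr a b + t * cr b c) <= t * cr a c ->
  see P a (t *: c) -> see P a (s *: b).
Proof.
move=> oa ob oc t01 s01 ab bc ac st satc.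
have cE x y (k : R) : cr x (k *: y) = k * cr x y.
  by rewrite /cr /= /GRing.scale /=; ring.
have cE' x y (k : R) : cr (k *: x) y = k * cr x y.
  by rewrite /cr /= /GRing.scale /=; ring.
have otc : see P 0 (t *: c) by apply: see_scale => //; lra.
have caa : cr a a = 0 by rewrite /cr; ring.
have d0 : 0 < cr a (t *: c) by rewrite cE mulr_gt0//; lra.
apply: (triangle_see Phf oa otc satc d0); split.
- by rewrite caa.
- exact: ltW.
- by rewrite caa add0r.
- by rewrite cE mulr_ge0// ?ltW//; lra.
- by rewrite cE' cE !mulr_ge0//; lra.
- by rewrite !cE cE'; move: st; lra.
Qed.

Lemma triangle_seer a b c (s t : R) : see P 0 a -> see P 0 b -> see P 0 c ->
  0 < t <= 1 -> 0 < s <= 1 -> 0 < cr b a -> 0 <= cr c b -> 0 < cr c a ->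
  s * (cr b a + t * cr c b) <= t * cr c a ->
  see P a (t *: c) -> see P a (s *: b).
Proof.
move=> oa ob oc t01 s01 ab bc ac st satc.
have cE x y (k : R) : cr x (k *: y) = k * cr x y.
  by rewrite /cr /= /GRing.scale /=; ring.
have cE' x y (k : R) : cr (k *: x) y = k * cr x y.
  by rewrite /cr /= /GRing.scale /=; ring.
have otc : see P 0 (t *: c) by apply: see_scale => //; lra.
have caa : cr a a = 0 by rewrite /cr; ring.
have d0 : 0 < cr (t *: c) a by rewrite cE' mulr_gt0//; lra.
apply: (triangle_see Phf otc oa (see_sym satc) d0); split.
- exact: ltW.
- by rewrite caa.
- by rewrite caa addr0.
- by rewrite cE' cE !mulr_ge0//; lra.
- by rewrite cE' mulr_ge0// ?ltW//; lra.
- by rewrite !cE' cE; move: st; lra.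
Qed.

(** If [a] saw some [t *: c], the triangle [0], [a], [t *: c] would contain an initial piece of the
    way towards [b], and [a] would see it. *)
Lemma blocked_monol a b c : see P 0 a -> see P 0 b -> see P 0 c ->
  0 < cr a b -> 0 <= cr b c -> 0 < cr a c -> blocked a b -> blocked a c.
Proof.
move=> oa ob oc ab bc ac h t t01 satc.
have d0 : 0 < cr a b + t * cr b c by rewrite ltr_pwDl// mulr_ge0//; lra.
(* The largest value that [triangle_seel] admits, capped at [1]. *)
pose s := Num.min 1 (t * cr a c / (cr a b + t * cr b c)).
have s01 : 0 < s <= 1.
  by rewrite lt_min ltr01 /= divr_gt0 ?mulr_gt0//=; [rewrite ge_min lexx|lra].
apply: (h s s01); apply: (triangle_seel oa ob oc t01 s01 ab bc ac _ satc).
by rewrite -ler_pdivlMr// ge_min lexx orbT.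
Qed.

Lemma blocked_monor a b c : see P 0 a -> see P 0 b -> see P 0 c ->
  0 < cr b a -> 0 <= cr c b -> 0 < cr c a -> blocked a b -> blocked a c.
Proof.
move=> oa ob oc ab bc ac h t t01 satc.
have d0 : 0 < cr b a + t * cr c b by rewrite ltr_pwDl// mulr_ge0//; lra.
pose s := Num.min 1 (t * cr c a / (cr b a + t * cr c b)).
have s01 : 0 < s <= 1.
  by rewrite lt_min ltr01 /= divr_gt0 ?mulr_gt0//=; [rewrite ge_min lexx|lra].
apply: (h s s01); apply: (triangle_seer oa ob oc t01 s01 ab bc ac _ satc).
by rewrite -ler_pdivlMr// ge_min lexx orbT.
Qed.

Lemma see_nested a b (s t : R) : see P 0 a -> see P 0 b -> 0 < s -> s <= t ->
  t <= 1 -> see P a (t *: b) -> see P a (s *: b).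
Proof.
move=> oa ob s0 st t1 satb.
have cbb : cr b b = 0 by rewrite /cr; ring.
have s01 : 0 < s <= 1 by lra.
have t01 : 0 < t <= 1 by lra.
have [ab|ab|ab] := ltgtP 0 (cr a b).
- by apply: (triangle_seel oa ob ob t01 s01 ab _ ab _ satb);
    rewrite cbb ?mulr0 ?addr0 ?ler_pM2r.
- have ba : 0 < cr b a.
    have -> : cr b a = - cr a b by rewrite /cr; ring.
    by rewrite oppr_gt0.
  by apply: (triangle_seer oa ob ob t01 s01 ba _ ba _ satb);
    rewrite cbb ?mulr0 ?addr0 ?ler_pM2r.
- apply: see_parallel => //; first by apply: see_scale => //; lra.
  have -> : cr a (s *: b) = s * cr a b by rewrite /cr /= /GRing.scale /=; ring.
  by rewrite -ab mulr0.
Qed.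

(** If [a] and [b] are strictly on one side of the line from [0] to [v], say in the order [v], [a],
    [b] around [0], then the segment from [b] to [v] breaks the blocking. Either it meets the
    segment from [0] to [a], and [b] sees the meeting point, or it passes beyond [a], and [b a] is a
    diagonal of the quadrilateral [b v a 0]. *)
Lemma see_blocked_pair a b v : see P 0 a -> see P 0 b -> 0 < cr a b ->
  blocked a b -> blocked b a -> see P v a -> see P v b -> see P 0 v.
Proof.
move=> oa ob ab bab bba va vb.
have [h|h] := leP (cr v a * cr v b) 0; first exact: (see_between oa ob).
exfalso.
have cN x y : cr x y = - cr y x by rewrite /cr; ring.
have [ap|ap] := ltP 0 (cr v a).
  have bp : 0 < cr v b by rewrite -(pmulr_rgt0 _ ap).
  have D0 : 0 < cr v a + cr a b by rewrite addr_gt0.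
  have Dn : cr v a + cr a b != 0 by rewrite gt_eqF.
  have [l1|l1] := leP (cr v b) (cr v a + cr a b).
    apply: (bba (cr v b / (cr v a + cr a b))).
      by rewrite divr_gt0//= ler_pdivrMr// mul1r.
    have -> : (cr v b / (cr v a + cr a b)) *: a =
        affine_path b v (cr a b / (cr v a + cr a b)).
      apply: plane_eq; rewrite affine_pathE /= /GRing.scale /=; apply: (mulfI Dn).
        have -> : (cr v a + cr a b) * (cr v b / (cr v a + cr a b) * a.1) =
          cr v b * a.1 by field.
        have -> : (cr v a + cr a b) * ((1 - cr a b / (cr v a + cr a b)) * b.1 +
          cr a b / (cr v a + cr a b) * v.1) = cr v a * b.1 + cr a b * v.1 by field.
        by rewrite /cr; ring.
      have -> : (cr v a + cr a b) * (cr v b / (cr v a + cr a b) * a.2) =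
        cr v b * a.2 by field.
      have -> : (cr v a + cr a b) * ((1 - cr a b / (cr v a + cr a b)) * b.2 +
        cr a b / (cr v a + cr a b) * v.2) = cr v a * b.2 + cr a b * v.2 by field.
      by rewrite /cr; ring.
    apply: see_subl; first exact: see_sym.
    by rewrite divr_ge0 ?(ltW ab) ?(ltW D0)//= ler_pdivrMr// mul1r ltW// ltrDr.
  apply: (bba 1); first by rewrite ltr01 lexx.
  rewrite scale1r; apply: (Phf (a := v) (b := 0)).
  - exact: see_sym.
  - exact: va.
  - exact: see_sym.
  - exact: ob.
  - have -> : cr (a - b) (v - b) = cr v b - (cr v a + cr a b).
      by rewrite /cr /=; ring.
    by rewrite subr_gt0.
  - have -> : cr (a - b) (0 - b) = - cr a b by rewrite /cr /=; ring.
    by rewrite oppr_lt0.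
have ap' : cr v a < 0.
  rewrite lt_neqAle ap andbT; apply/eqP => e0.
  by move: h; rewrite e0 mul0r ltxx.
have bp : cr v b < 0 by rewrite -(nmulr_rgt0 _ ap').
have {ap ap'}ap : 0 < cr a v by rewrite cN oppr_gt0.
have {}bp : 0 < cr b v by rewrite cN oppr_gt0.
have D0 : 0 < cr a b + cr b v by rewrite addr_gt0.
have Dn : cr a b + cr b v != 0 by rewrite gt_eqF.
have [l1|l1] := leP (cr a v) (cr a b + cr b v).
  apply: (bab (cr a v / (cr a b + cr b v))).
    by rewrite divr_gt0//= ler_pdivrMr// mul1r.
  have -> : (cr a v / (cr a b + cr b v)) *: b =
      affine_path a v (cr a b / (cr a b + cr b v)).
    apply: plane_eq; rewrite affine_pathE /= /GRing.scale /=; apply: (mulfI Dn).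
      have -> : (cr a b + cr b v) * (cr a v / (cr a b + cr b v) * b.1) =
        cr a v * b.1 by field.
      have -> : (cr a b + cr b v) * ((1 - cr a b / (cr a b + cr b v)) * a.1 +
        cr a b / (cr a b + cr b v) * v.1) = cr b v * a.1 + cr a b * v.1 by field.
      by rewrite /cr; ring.
    have -> : (cr a b + cr b v) * (cr a v / (cr a b + cr b v) * b.2) =
      cr a v * b.2 by field.
    have -> : (cr a b + cr b v) * ((1 - cr a b / (cr a b + cr b v)) * a.2 +
      cr a b / (cr a b + cr b v) * v.2) = cr b v * a.2 + cr a b * v.2 by field.
    by rewrite /cr; ring.
  apply: see_subl; first exact: see_sym.
  by rewrite divr_ge0 ?(ltW ab) ?(ltW D0)//= ler_pdivrMr// mul1r ltW// ltrDl.
apply: (bab 1); first by rewrite ltr01 lexx.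
rewrite scale1r; apply: (Phf (a := 0) (b := v)).
- exact: see_sym.
- exact: ob.
- exact: see_sym.
- exact: va.
- by have -> : cr (b - a) (0 - a) = cr a b by rewrite /cr /=; ring.
- have -> : cr (b - a) (v - a) = (cr a b + cr b v) - cr a v.
    by rewrite /cr /=; ring.
  by rewrite subr_lt0.
Qed.

End Star.
End Kernel.

(** * Existence of the centre *)

Section Centre.
Variable R : realType.
Local Notation plane := (R * R)%type.
Implicit Types (P : set plane) (x y z : plane).

(* Let [m] have the largest key among the elements blocked from above, say by
   [a'], and let [a] have the least key among those blocking [a'] from below. If
   [k m < k a], then [a] is blocked from below, and its blocker blocks [a'] too. *)
Lemma mutual_pair (I : finType) (i0 : I) (k : I -> R) (blk : I -> I -> Prop) :
  (forall b, exists a, blk a b) -> (forall a b, blk a b -> k a != k b) ->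
  (forall a b c, k a < k b -> k b <= k c -> blk a b -> blk a c) ->
  (forall a b c, k b < k a -> k c <= k b -> blk a b -> blk a c) ->
  exists a b, [/\ k a < k b, blk a b & blk b a].
Proof.
move=> stuck neq up down.
pose L b := `[< exists a, k b < k a /\ blk a b >].
have [bm _ bmP] : exists2 b, true & forall c, k b <= k c.
  by case: (@Order.TotalTheory.arg_minP _ _ _ i0 xpredT k) => // b _ h; exists b => // c; exact: h.
have Lbm : L bm.
  apply/asboolP; have [a ab] := stuck bm; exists a; split => //.
  by rewrite lt_neqAle bmP eq_sym neq.
case: (@Order.TotalTheory.arg_maxP _ _ _ bm L k Lbm) => m /asboolP[a' [ma' ba']] mP.
have LF a : k m < k a -> ~ L a.
  by move=> ma La; have : k a <= k m := mP a La; rewrite leNgt ma.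
have lower a : k m < k a -> exists b, k b < k a /\ blk b a.
  move=> ma; have [b ba] := stuck a; exists b; split => //.
  have [//|ab] := ltP (k b) (k a); exfalso; apply: (LF _ ma); apply/asboolP.
  by exists b; split => //; rewrite lt_neqAle ab eq_sym neq.
pose M a := `[< k a < k a' /\ blk a a' >].
have [a0 Ma0] : exists a0, M a0.
  by have [a0 h] := lower _ ma'; exists a0; apply/asboolP.
case: (@Order.TotalTheory.arg_minP _ _ _ a0 M k Ma0) => a /asboolP[aa' ba] aP.
have am : k a <= k m.
  rewrite leNgt; apply/negP => /lower[b [bka bba]].
  have Mb : M b.
    by apply/asboolP; split; [exact: lt_trans aa'|apply: up bba => //; exact: ltW].
  by have : k a <= k b := aP b Mb; rewrite leNgt bka.
by exists a, a'; split => //; apply: down ba'.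
Qed.

Definition dot x y : R := x.1 * y.1 + x.2 * y.2.

Definition positively_dependent (l : seq plane) :=
  exists a b c, [/\ a \in l, b \in l, c \in l & exists p q r : R,
    [/\ 0 <= p, 0 <= q, 0 <= r, 0 < p + q + r & p *: a + q *: b + r *: c = 0]].

(* Caratheodory's theorem combined with Gordan's alternative, in the plane. *)
Lemma gordan (l : seq plane) :
  positively_dependent l \/ exists u, forall x, x \in l -> 0 < dot u x.
Proof.
elim: l => [|x l [[a [b [c [al bl cl h]]]]|[u ul]]].
- by right; exists 0.
- by left; exists a, b, c; split => //; rewrite inE ?al ?bl ?cl orbT.
case: l ul => [|y l] ul.
  have [x0|x0] := eqVneq x 0.
    left; exists x, x, x; split; rewrite ?inE ?eqxx//.
    exists 1, 0, 0; split; rewrite ?addr0 ?ler01 ?ltr01//.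
    by rewrite x0 !scaler0 !addr0.
  right; exists x => y; rewrite inE => /eqP ->.
  rewrite /dot -!expr2 lt_neqAle addr_ge0 ?sqr_ge0// andbT eq_sym.
  apply: contra x0; rewrite paddr_eq0 ?sqr_ge0// !sqrf_eq0 => /andP[/eqP e1 /eqP e2].
  by apply/eqP/plane_eq.
set l' := y :: l in ul *.
have [xp|xn] := ltP 0 (dot u x).
  by right; exists u => w; rewrite inE => /orP[/eqP ->|/ul].
(* The tangent of the angle from [u]. It orders [l'] around the origin, since [l'] lies in the open
   half-plane of [u]. *)
pose k w := cr u w / dot u w.
have crk v w : v \in l' -> w \in l' -> (0 <= cr v w) = (k v <= k w).
  move=> /ul v0 /ul w0.
  rewrite /k ler_pdivrMr// mulrAC ler_pdivlMr//.
  have [u0|u0] := eqVneq (dot u u) 0.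
    have := v0; rewrite /dot.
    have /eqP u10 : u.1 == 0.
      by rewrite -sqrf_eq0; apply/eqP; move: (sqr_ge0 u.1) (sqr_ge0 u.2) u0;
        rewrite /dot; lra.
    have /eqP u20 : u.2 == 0.
      by rewrite -sqrf_eq0; apply/eqP; move: (sqr_ge0 u.1) (sqr_ge0 u.2) u0;
        rewrite /dot; lra.
    by rewrite u10 u20 !mul0r addr0 ltxx.
  have u0' : 0 < dot u u.
    by rewrite lt_neqAle eq_sym u0 /dot addr_ge0// -expr2 sqr_ge0.
  rewrite -(pmulr_rge0 _ u0').
  have -> : dot u u * cr v w = cr u w * dot u v - cr u v * dot u w.
    by rewrite /dot /cr; ring.
  by rewrite subr_ge0.
have ext (o : rel R) : total o -> transitive o ->
    exists2 a, a \in l' & forall w, w \in l' -> o (k a) (k w).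
  move=> oT otr; rewrite /l'; elim: l y {ul l' crk} => [|w l IH] y.
    exists y; rewrite ?inE// => w; rewrite inE => /eqP ->.
    by have := oT (k y) (k y); rewrite orbb.
  have [a al h] := IH w.
  have [ya|ay] := orP (oT (k y) (k a)).
    exists y; rewrite ?mem_head// => v; rewrite inE => /orP[/eqP ->|/h].
      by have := oT (k y) (k y); rewrite orbb.
    exact: otr.
  exists a; first by rewrite inE al orbT.
  by move=> v; rewrite inE => /orP[/eqP ->|/h].
have [a al ale] := ext <=%R (@le_total _ _) (@le_trans _ _).
have [b bl bge] := ext >=%R (fun r1 r2 => le_total r2 r1)
  (fun r2 r1 r3 h1 h2 => le_trans h2 h1).
have av w : w \in l' -> 0 <= cr a w by move=> wl; rewrite crk// ale.
have vb w : w \in l' -> 0 <= cr w b by move=> wl; rewrite crk//; exact: bge.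
have ua := ul _ al; have ub := ul _ bl.
(* If [x] is strictly to the left of [a], the first vector of [l'], then the normal of [a] tilted
   towards [u] is positive everywhere; [e] is chosen so that its value at [x] is [e]. The case of
   the last vector [b] is symmetric. *)
have [c1|c1] := ltP 0 (cr a x).
  right; pose e := cr a x / (1 - dot u x).
  have d1 : 0 < 1 - dot u x by lra.
  have e0 : 0 < e by rewrite divr_gt0.
  exists (- a.2 + e * u.1, a.1 + e * u.2) => w.
  have -> : dot (- a.2 + e * u.1, a.1 + e * u.2) w = cr a w + e * dot u w.
    by rewrite /dot /cr /=; ring.
  rewrite inE => /orP[/eqP ->|wl].
    have ee : e * (1 - dot u x) = cr a x by rewrite /e divfK// gt_eqF.
    have -> : cr a x + e * dot u x = e by rewrite -ee; ring.
    exact: e0.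
  by rewrite ltr_wpDl ?av// mulr_gt0// ul.
have [c2|c2] := ltP 0 (cr x b).
  right; pose e := cr x b / (1 - dot u x).
  have d1 : 0 < 1 - dot u x by lra.
  have e0 : 0 < e by rewrite divr_gt0.
  exists (b.2 + e * u.1, - b.1 + e * u.2) => w.
  have -> : dot (b.2 + e * u.1, - b.1 + e * u.2) w = cr w b + e * dot u w.
    by rewrite /dot /cr /=; ring.
  rewrite inE => /orP[/eqP ->|wl].
    have ee : e * (1 - dot u x) = cr x b by rewrite /e divfK// gt_eqF.
    have -> : cr x b + e * dot u x = e by rewrite -ee; ring.
    exact: e0.
  by rewrite ltr_wpDl ?vb// mulr_gt0// ul.
have inl w : w \in l' -> w \in x :: l' by move=> wl; rewrite inE wl orbT.
(* Now [x] is in the cone opposite to the one spanned by [a] and [b]. If [x] is on the line of [a],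
   two vectors are dependent; otherwise the coefficients come from the linear relation between three
   plane vectors. *)
left; have [c3|c3] := eqVneq (cr a x) 0.
  exists x, a, a; split; rewrite ?mem_head ?inl//.
  exists (dot u a), (- dot u x), 0; split => //.
  - exact: ltW.
  - by rewrite oppr_ge0.
  - by rewrite addr0 ltr_wpDr ?oppr_ge0.
  - apply: plane_eq; rewrite /= /GRing.scale /=.
      have -> : dot u a * x.1 + - dot u x * a.1 + 0 * a.1 = - u.2 * cr a x.
        by rewrite /dot /cr; ring.
      by rewrite c3 mulr0.
    have -> : dot u a * x.2 + - dot u x * a.2 + 0 * a.2 = u.1 * cr a x.
      by rewrite /dot /cr; ring.
    by rewrite c3 mulr0.
have c3' : cr a x < 0 by rewrite lt_neqAle c3.
exists x, a, b; split; rewrite ?mem_head ?inl//.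
exists (cr a b), (- cr x b), (- cr a x); split.
- exact: av.
- by rewrite oppr_ge0.
- by rewrite oppr_ge0 ltW.
- by rewrite ltr_wpDl ?oppr_gt0// addr_ge0 ?av// oppr_ge0.
- by apply: plane_eq; rewrite /= /GRing.scale /= /cr; ring.
Qed.

Lemma closed_see P s : closed P -> closed [set z | see P z s].
Proof.
move=> Pc.
have -> : [set z | see P z s] =
    \bigcap_(t in `[0, 1]%classic) ((fun z => affine_path z s t) @^-1` P).
  apply/seteqP; split=> [z h t|z h t t01] /=.
    by rewrite in_itv /=; exact: h.
  by apply: (h t); rewrite /= in_itv.
apply: closed_bigI => t _; apply: preimage_closed => //.
move=> z _; apply: cvgD; last exact: cvg_cst.
by apply: cvgZ; [exact: cvg_cst|exact: cvg_id].
Qed.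

(* Among the convex combinations of [c] and the [s i] that lie in [K], take one
   that gives [c] the least possible weight. *)
Lemma closest_point n (s : 'I_n -> plane) (c : plane) (K : set plane) :
  closed K -> K c -> exists2 z, K z &
    (exists w : 'I_n -> R, [/\ forall i, 0 <= w i, \sum_i w i = 1 &
       \sum_i w i *: (s i - z) = 0]) \/
    forall i (t : R), 0 < t <= 1 -> ~ K (affine_path z (s i) t).
Proof.
move=> Kc cK.
(* Index [ord0] stands for [c], the others for the [s i]; [W] is the compact set of weights whose
   combination lies in [K]. *)
pose q (j : 'I_n.+1) := if unlift ord0 j is Some i then s i else c.
pose Z (l : 'rV[R]_n.+1) := \sum_j l ord0 j *: q j.
pose W := [set l : 'rV[R]_n.+1 | [/\ forall j, 0 <= l ord0 j,
  \sum_j l ord0 j = 1 & K (Z l)]].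
have cj j : continuous (fun l : 'rV[R]_n.+1 => l ord0 j).
  exact: coord_continuous.
have Zc : continuous Z.
  apply: continuous_big => [|j _ l]; first exact: add_continuous.
  by apply: cvgZ; [exact: nbhs_filter|exact: (cj j l)|apply: cvg_cst; exact: nbhs_filter].
have Sc : continuous (fun l : 'rV[R]_n.+1 => \sum_j l ord0 j).
  apply: continuous_big => [|j _ l]; first exact: add_continuous.
  exact: cj.
have Wc : closed W.
  have -> : W = \bigcap_j [set l : 'rV[R]_n.+1 | 0 <= l ord0 j] `&`
      ((fun l : 'rV[R]_n.+1 => \sum_j l ord0 j) @^-1` [set 1] `&` Z @^-1` K).
    by apply/seteqP; split=> [l [h1 h2 h3]|l [h1 [h2 h3]]]; split => // j *; apply: h1.
  apply: closedI; last first.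
    by apply: closedI; apply: preimage_closed => //; exact: closed1.
  apply: closed_bigI => j _.
  apply: (@preimage_closed _ _ (fun l : 'rV[R]_n.+1 => l ord0 j) [set x | 0 <= x]).
    by move=> l _; exact: cj.
  exact: closed_ge.
have Wb : bounded_set W.
  exists 1; split; first exact: num_real.
  move=> M M1 l [l0 l1 _].
  rewrite /= [leLHS]/Num.Def.normr /= mx_normrE; apply/bigmax_leP; split => [|[i j] _] /=.
    by rewrite (le_trans ler01)// ltW.
  rewrite (ord1 i) ger0_norm// (le_trans _ (ltW M1))// -l1 (bigD1 j)//= lerDl.
  exact: sumr_ge0.
have W0 : W !=set0.
  exists (\row_j (j == ord0)%:R); split.
  - by move=> j; rewrite mxE ler0n.
  - rewrite (bigD1 ord0)//= mxE eqxx big1 ?addr0// => j j0.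
    by rewrite mxE (negPf j0).
  - rewrite /Z (bigD1 ord0)//= mxE eqxx big1 ?addr0.
      by rewrite scale1r /q unlift_none.
    by move=> j j0; rewrite mxE (negPf j0) scale0r.
have [l lW lmin] := @EVT_min_rV R n.+1 (fun l => l ord0 ord0) W W0
  (bounded_closed_compact Wb Wc) (continuous_subspaceT (@cj _)).
move: lW; rewrite inE => -[l0 l1 lK].
exists (Z l) => //.
have ZE : Z l = l ord0 ord0 *: c + \sum_i l ord0 (lift ord0 i) *: s i.
  rewrite /Z big_ord_recl /q unlift_none; congr (_ + _).
  by apply: eq_bigr => i _; rewrite liftK.
have sE : l ord0 ord0 + \sum_i l ord0 (lift ord0 i) = 1.
  by rewrite -l1 big_ord_recl.
have [l00|l00] := eqVneq (l ord0 ord0) 0.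
  left; exists (fun i => l ord0 (lift ord0 i)); split => //.
    by rewrite -sE l00 add0r.
  under eq_bigr do rewrite scalerBr.
  rewrite sumrB -scaler_suml [X in _ - X *: _](_ : _ = 1); last first.
    by rewrite -sE l00 add0r.
  by rewrite scale1r ZE l00 scale0r add0r subrr.
right=> i t /andP[t0 t1] Kt.
(* Moving towards [s i] by [t] multiplies the positive weight of [c] by [1 - t], against
   minimality. *)
pose l' := (1 - t) *: l + t *: (\row_j (j == lift ord0 i)%:R : 'rV[R]_n.+1).
have ZE' : Z l' = affine_path (Z l) (s i) t.
  rewrite /Z /affine_path scaler_sumr.
  have -> : s i = \sum_j (j == lift ord0 i)%:R *: q j.
    rewrite (bigD1 (lift ord0 i))//= eqxx scale1r big1 ?addr0 /q ?liftK//.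
    by move=> j /negPf ->; rewrite scale0r.
  rewrite scaler_sumr -big_split /=; apply: eq_bigr => j _.
  by rewrite /l' !mxE [in LHS]scalerDl !scalerA.
have : l' \in W.
  rewrite inE; split.
  - move=> j; rewrite /l' !mxE addr_ge0// mulr_ge0//; [|exact: ltW].
    by rewrite subr_ge0.
  - under eq_bigr do rewrite /l' !mxE.
    rewrite big_split /= -!mulr_sumr l1 (bigD1 (lift ord0 i))//= eqxx big1.
      by rewrite addr0 !mulr1 subrK.
    by move=> j /negPf ->.
  - by rewrite ZE'.
move/lmin; rewrite /l' !mxE /= mulr0 addr0 mulrBl mul1r lerDl oppr_ge0 leNgt => /negP; apply.
by rewrite mulr_gt0// lt_neqAle eq_sym l00 l0.
Qed.

Lemma dot_sum I (r : seq I) (w : I -> R) (x : I -> plane) u :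
  dot u (\sum_(i <- r) w i *: x i) = \sum_(i <- r) w i * dot u (x i).
Proof.
rewrite (big_morph (dot u) (id1 := 0) (op1 := +%R)).
- by apply: eq_bigr => i _; rewrite /dot /= /GRing.scale /=; ring.
- by move=> v w'; rewrite /dot /=; ring.
- by rewrite /dot /=; ring.
Qed.

(* [z] comes from [closest_point]. If the vectors [s i - z] are positively
   dependent, three of them are; otherwise two of them block each other. *)
Lemma centre P n (s : 'I_n.+1 -> plane) c : hole_free P -> closed P ->
  (forall i, see P c (s i)) -> exists z, (forall i, see P z (s i)) /\
  exists i j k, forall v,
    see P v (s i) -> see P v (s j) -> see P v (s k) -> see P v z.
Proof.
move=> Phf Pc cs.
have Kc : closed [set z | forall i, see P z (s i)].
  have -> : [set z | forall i, see P z (s i)] =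
      \bigcap_i [set z | see P z (s i)].
    by apply/seteqP; split=> [z h i _|z h i]; apply: h.
  by apply: closed_bigI => i _; exact: closed_see.
have [z zs zK] := closest_point s Kc cs; exists z; split => //.
pose Q : set plane := translate P z; pose x i : plane := s i - z.
have Qhf : hole_free Q by exact: hole_free_translate.
have toQ v i : see P v (s i) <-> see Q (v - z) (x i).
  by rewrite /Q see_translate /x !subrK.
have Qz v : see Q 0 (v - z) -> see P v z.
  by move/see_translate; rewrite add0r subrK => /see_sym.
have ox i : see Q 0 (x i) by rewrite -(subrr z); exact/toQ.
have [[a [b [d [/mapP[i _ ->] /mapP[j _ ->] /mapP[k _ ->]]]]]|[u uP]] :=
    gordan [seq x i | i <- enum 'I_n.+1].
  move=> [p [q [r [p0 q0 r0 pqr e]]]]; exists i, j, k => v /toQ vi /toQ vj /toQ vk.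
  by apply: Qz; exact: (see_hull Qhf (ox i) (ox j) (ox k) vi vj vk p0 q0 r0).
have {}uP i : 0 < dot u (x i) by apply: uP; rewrite map_f// mem_enum.
(* A vanishing convex combination of the [x i] is impossible, as [u] is positive on all of them. *)
case: zK => [[w [w0 w1 we]]|zK].
  have : \sum_i w i * dot u (x i) = 0.
    by rewrite -dot_sum we /dot /= !mulr0 addr0.
  move/eqP; rewrite psumr_eq0; last by move=> i _; rewrite mulr_ge0// ltW.
  move/allP => h; move: w1; rewrite big1 => [/esym/eqP|i _].
    by rewrite oner_eq0.
  have := h i (mem_index_enum i).
  by rewrite /= mulf_eq0 [X in _ || X]gt_eqF// orbF => /eqP.
(* If nothing blocked the way towards [x b], every [x a] would see a point on it, and by
   [see_nested] the nearest of these points. The centre could then be moved there. *)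
have stuck b : exists a, blocked Q (x a) (x b).
  apply: contrapT => /forallNP nb.
  have /choice[t tP] a : exists t, 0 < t <= 1 /\ see Q (x a) (t *: x b).
    have := nb a; rewrite /blocked => /existsNP[t /not_implyP[t01 /contrapT h]].
    by exists t.
  case: (@Order.TotalTheory.arg_minP _ _ _ ord0 xpredT t) => // m _ tm.
  have [/andP[tm0 tm1] _] := tP m.
  apply: (zK b (t m)); first by rewrite tm0.
  move=> a.
  have e : t m *: x b = affine_path z (s b) (t m) - z.
    by apply: plane_eq; rewrite affine_pathE /= /GRing.scale /=; ring.
  have [/andP[_ ta1] h] := tP a.
  have := see_nested Qhf (ox a) (ox b) tm0 (tm a isT) ta1 h.
  by rewrite e => h'; apply/toQ; exact: see_sym.
have u0 : 0 < dot u u.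
  rewrite lt_neqAle eq_sym /dot addr_ge0 -?expr2 ?sqr_ge0// andbT.
  rewrite paddr_eq0 ?sqr_ge0// !sqrf_eq0; apply/negP => /andP[/eqP u1 /eqP u2].
  by have := uP ord0; rewrite /dot u1 u2 !mul0r addr0 ltxx.
pose k i := cr u (x i) / dot u (x i).
have crE a b : dot u u * cr (x a) (x b) =
    dot u (x a) * dot u (x b) * (k b - k a).
  have -> : dot u u * cr (x a) (x b) =
      cr u (x b) * dot u (x a) - cr u (x a) * dot u (x b).
    by rewrite /dot /cr; ring.
  rewrite mulrBr /k -[X in _ = X - _]mulrA (mulrC (dot u (x a)) (dot u (x b))).
  rewrite [in RHS]mulrA.
  have e i : cr u (x i) = k i * dot u (x i) by rewrite /k divfK// gt_eqF.
  rewrite !e /k !mulfK ?gt_eqF//; ring.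
have crk a b : (0 < cr (x a) (x b)) = (k a < k b).
  by rewrite -(pmulr_rgt0 _ u0) crE pmulr_rgt0 ?mulr_gt0// subr_gt0.
have crk' a b : (0 <= cr (x a) (x b)) = (k a <= k b).
  by rewrite -(pmulr_rge0 _ u0) crE pmulr_rge0 ?mulr_gt0// subr_ge0.
have [a [b [ab blab blba]]] : exists a b,
    [/\ k a < k b, blocked Q (x a) (x b) & blocked Q (x b) (x a)].
  apply: (mutual_pair ord0 stuck) => [a b blab|a b d ab bd|a b d ba db].
  - apply/eqP => kab; apply: (blab 1); rewrite ?ltr01 ?lexx// scale1r.
    apply: see_parallel => //.
    have : cr (x a) (x b) * dot u u = 0.
      by rewrite mulrC crE kab subrr mulr0.
    by move/eqP; rewrite mulf_eq0 [X in _ || X]gt_eqF// orbF => /eqP.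
  - by apply: (blocked_monol Qhf (ox a) (ox b) (ox d));
      rewrite ?crk ?crk'//; exact: lt_le_trans bd.
  - by apply: (blocked_monor Qhf (ox a) (ox b) (ox d));
      rewrite ?crk ?crk'//; exact: le_lt_trans ba.
exists a, b, a => v /toQ va /toQ vb _; apply: Qz.
by apply: (see_blocked_pair Qhf (ox a) (ox b)) => //; rewrite crk.
Qed.

End Centre.

(** * Shattered sets *)

Section Shattering.
Import boot.fintype boot.finset.
Local Open Scope set_scope.
Local Open Scope nat_scope.
Variable I : finType.
Implicit Types (F G : {set {set I}}) (A B T : {set I}).

Definition shatters F A :=
  [forall B : {set I}, (B \subset A) ==> [exists T in F, T :&: A == B]].

Lemma shattersP F A : reflect (forall B, B \subset A ->
  exists2 T, T \in F & T :&: A = B) (shatters F A).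
Proof.
apply: (iffP forallP) => [h B BA|h B].
  by have /implyP/(_ BA)/exists_inP[T TF /eqP] := h B; exists T.
by apply/implyP => /h[T TF <-]; apply/exists_inP; exists T.
Qed.

Lemma shattersS F G A B :
  F \subset G -> B \subset A -> shatters F A -> shatters G B.
Proof.
move=> /subsetP FG BA /shattersP h; apply/shattersP => C CB.
have [T TF TA] := h C (subset_trans CB BA); exists T; first exact: FG.
by rewrite -(setIidPr BA) setIA TA; exact/setIidPl.
Qed.

(* Pajor's strengthening of the Sauer-Shelah lemma. *)
Lemma card_shatters F : (#|F| <= #|[set A | shatters F A]|)%N.
Proof.
have [n] := ubnP #|F|; elim: n F => // n IH F; rewrite ltnS => Fn.
have [F1|F1] := leqP #|F| 1.
  have [->|[T TF]] := set_0Vmem F; first by rewrite cards0.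
  apply: (leq_trans F1); rewrite card_gt0; apply/set0Pn; exists set0.
  rewrite inE; apply/shattersP => B; rewrite subset0 => /eqP ->.
  by exists T; rewrite ?setI0.
have [T0 [T1 [T0F T1F T01]]] := card_gt1P F1.
have [d dT] : exists d, (d \in T0) != (d \in T1).
  apply/existsP; rewrite -negb_forall; apply: contra T01 => /forallP h.
  by apply/eqP/setP => d; exact/eqP.
(* Both halves of [F], split by membership of [d], are nonempty, so induction applies. A set
   shattered by both halves is counted twice, and [F] shatters it with and without [d]. *)
pose G b := [set T in F | (d \in T) == b].
have GF b : G b \subset F by apply/subsetP => T; rewrite inE => /andP[].
have FE : (#|F| = #|G true| + #|G false|)%N.
  rewrite -(cardsID (G true) F) (setIidPr (GF true)); congr (_ + _)%N; apply: eq_card => T.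
  by rewrite !inE; case: (T \in F); case: (d \in T).
have Gp b : (0 < #|G b|)%N.
  rewrite card_gt0; apply/set0Pn.
  have [e|e] := eqVneq (d \in T0) b; [exists T0|exists T1].
    by rewrite inE T0F e eqxx.
  by rewrite inE T1F; move: dT e; case: (d \in T0); case: (d \in T1); case: (b).
pose S b := [set A | shatters (G b) A].
have IHb b : (#|G b| <= #|S b|)%N.
  apply: IH; apply: leq_trans Fn; rewrite FE.
  by have := Gp (~~ b); case: (b) => /= h; lia.
have dS b A : A \in S b -> d \notin A.
  rewrite inE => /shattersP h; apply/negP => dA.
  have [T] := h (if b then set0 else [set d])
    ltac:(by case: (b); rewrite ?sub0set ?sub1set).
  rewrite inE => /andP[_ /eqP Td] /setP/(_ d).
  by rewrite inE Td dA andbT; case: (b); rewrite !inE ?eqxx.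
pose D := [set d |: A | A in S true :&: S false].
have cD : #|D| = #|S true :&: S false|.
  apply: card_in_imset => A B /setIP[/(dS true) dA _] /setIP[/(dS true) dB _] e.
  by rewrite -(setU1K dA) e setU1K.
rewrite FE.
apply: leq_trans (leq_add (IHb true) (IHb false)) _.
rewrite -cardsUI -cD -cardsUI addnC.
have -> : (S true :|: S false) :&: D = set0.
  apply/setP => A; rewrite [RHS]inE; apply/negP => /setIP[h].
  move=> /imsetP[B _ e]; have : d \notin A by case/setUP: h => /dS.
  by rewrite e setU11.
rewrite cards0 add0n; apply/subset_leq_card/subsetP => A.
move=> /setUP[/setUP[]|/imsetP[B]].
- by rewrite !inE; apply: shattersS.
- by rewrite !inE; apply: shattersS.
rewrite !inE => /andP[/shattersP h1 /shattersP h2 ->].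
apply/shattersP => C CdB.
have CB : C :\ d \subset B by rewrite subDset.
have dB : d \notin B by apply: (dS true); rewrite inE; exact/shattersP.
pose b := d \in C.
have [T] : exists2 T, T \in G b & T :&: B = C :\ d.
  by case: (b); [exact: h1|exact: h2].
rewrite inE => /andP[TF /eqP Td] e; exists T => //.
apply/setP => f; move/setP/(_ f): e; rewrite !inE.
by have [->|] := eqVneq f d; rewrite ?Td ?andbT.
Qed.

End Shattering.

(** * Splittings of the points by lines through the centre *)

Section HalfplaneClasses.
Import boot.fintype boot.finset.
Local Open Scope set_scope.
Local Open Scope ring_scope.
Variable R : realType.
Local Notation plane := (R * R)%type.

(** A splitting is recorded as the set of [e] such that [p] is to the left of [x e] or on its line
    through [0]. *)
Definition left_of (I : finType) (x : I -> plane) (p : plane) : {set I} :=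
  [set e | 0 <= cr (x e) p].

(** The quotient of [cr e p] by [p.2] depends only on [p.1 / p.2], as an affine function with slope
    [- e.2]. *)
Lemma left_of_mono (e p q : plane) : 0 < p.2 * q.2 ->
  e.2 * cr p q * p.2 <= 0 -> 0 <= cr e q -> 0 <= cr e p.
Proof.
move=> pq epq eq; rewrite -(pmulr_lge0 _ pq).
have -> : cr e p * (p.2 * q.2) = p.2 ^+ 2 * cr e q - e.2 * cr p q * p.2.
  by rewrite /cr; ring.
by rewrite subr_ge0 (le_trans epq)// mulr_ge0// sqr_ge0.
Qed.

(* As [p] moves along a horizontal line, the points [x e] above the origin
   leave [left_of x p] one after the other and those below enter it, or vice
   versa. *)
Lemma card_left_of (I J : finType) (x : I -> plane) (y : J -> plane) :
  (#|[set left_of x (y t) | t : J]| <= 2 * #|I|.+1 + 3)%N.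
Proof.
set n := #|I|; pose cl t := left_of x (y t).
pose X := [set e | (x e).2 < 0].
(* Along a horizontal line both sets shrink in the same direction, so equal values of [phi] force
   equal classes. *)
pose phi t := (#|cl t :\: X| + #|X :\: cl t|)%N.
have phin t : (phi t <= n)%N.
  rewrite /phi -cardsUI [X in (_ + #|pred_of_set X|)%N](_ : _ = set0).
    by rewrite cards0 addn0 max_card.
  by apply/setP => e; rewrite !inE; case: (_ <= _); rewrite ?andbF.
have chain t t' : 0 < (y t).2 * (y t').2 -> cr (y t) (y t') * (y t).2 <= 0 ->
    phi t = phi t' -> cl t = cl t'.
  move=> tt crt ph.
  have tt' : 0 < (y t').2 * (y t).2 by rewrite mulrC.
  have crt' : 0 <= cr (y t') (y t) * (y t').2.
    rewrite -(pmulr_rge0 _ tt).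
    have -> : (y t).2 * (y t').2 * (cr (y t') (y t) * (y t').2) =
      - (cr (y t) (y t') * (y t).2) * (y t').2 ^+ 2 by rewrite /cr; ring.
    by rewrite mulr_ge0 ?sqr_ge0// oppr_ge0.
  have s1 : cl t' :\: X \subset cl t :\: X.
    apply/subsetP => e; rewrite !inE -leNgt => /andP[e0]; rewrite e0 /=.
    by apply: left_of_mono => //; rewrite -mulrA mulr_ge0_le0.
  have s2 : X :\: cl t' \subset X :\: cl t.
    apply/subsetP => e; rewrite !inE => /andP[h e0]; rewrite e0 andbT.
    apply: contra h; apply: left_of_mono => //.
    by rewrite -mulrA mulr_le0_ge0// ltW.
  have c1 := subset_leq_card s1; have c2 := subset_leq_card s2.
  have e1 : cl t' :\: X = cl t :\: X.
    by apply/eqP; rewrite eqEcard s1 /=; move: ph c1 c2; rewrite /phi; lia.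
  have e2 : X :\: cl t' = X :\: cl t.
    by apply/eqP; rewrite eqEcard s2 /=; move: ph c1 c2; rewrite /phi; lia.
  apply/setP => e; move/setP/(_ e): e1; move/setP/(_ e): e2; rewrite !in_setD.
  by case: (e \in X); case: (e \in cl t); case: (e \in cl t').
have same t t' : 0 < (y t).2 * (y t').2 -> phi t = phi t' -> cl t = cl t'.
  move=> tt ph; have [h|h] := leP (cr (y t) (y t') * (y t).2) 0.
    exact: chain.
  apply/esym; apply: chain => //; first by rewrite mulrC.
  rewrite -(pmulr_rle0 _ tt).
  have -> : (y t).2 * (y t').2 * (cr (y t') (y t) * (y t').2) =
    - (cr (y t) (y t') * (y t).2 * (y t').2 ^+ 2) by rewrite /cr; ring.
  by rewrite oppr_le0 mulr_ge0 ?sqr_ge0// ltW.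
(* There are [n.+1] values for viewpoints above the horizontal axis, [n.+1] for those below, and
   three on the axis: right of the origin, left of it, and the origin. *)
pose key t := if 0 < (y t).2 then phi t else
  if (y t).2 < 0 then (n.+1 + phi t)%N else
  (2 * n.+1 + (if (0 < (y t).1)%R then 0 else if ((y t).1 < 0)%R then 1 else 2))%N.
have keyn t : (key t < 2 * n.+1 + 3)%N.
  have := phin t; rewrite /key; case: ifP => _; first by lia.
  case: ifP => _; first by lia.
  by case: ifP => _; last case: ifP => _; lia.
have keyP t t' : key t = key t' -> cl t = cl t'.
  have := phin t; have := phin t'; rewrite /key.
  case: (ltrgt0P (y t).2) => t2; case: (ltrgt0P (y t').2) => t'2 p1 p2 e;
    try by exfalso; move: p1 p2 e; do ?[case: ifP => _]; lia.
  - by apply: same => //; rewrite mulr_gt0.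
  - by apply: same; [rewrite nmulr_rgt0|lia].
  apply/setP => i; rewrite !inE /cr t2 t'2 !mulr0 !sub0r !oppr_ge0.
  move: e; case: (ltrgt0P (y t).1) => t1; case: (ltrgt0P (y t').1) => t'1;
    try by move=> h; exfalso; lia.
  - by rewrite !pmulr_lle0.
  - by rewrite !nmulr_lle0.
  - by rewrite t1 t'1.
pose K t : 'I_(2 * n.+1 + 3) := Ordinal (keyn t).
rewrite -[X in (_ <= X)%N]card_ord.
have rep (s : {set I}) : s \in [set left_of x (y t) | t : J] ->
    exists t, s = cl t by move=> /imsetP[t _ ->]; exists t.
(* The default [0] is never taken on the sets that occur, as each is the class of some [t]. *)
pose kap (s : {set I}) := if [pick t | cl t == s] is Some t then K t else
  Ordinal (ltn_addl (2 * n.+1) (isT : (0 < 3)%N)).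
rewrite -(card_in_imset (f := kap)); first exact: max_card.
move=> s s' /rep[t ->] /rep[t' ->]; rewrite /kap.
case: pickP => [r /eqP er|/(_ t)]; last by rewrite eqxx.
case: pickP => [r' /eqP er'|/(_ t')]; last by rewrite eqxx.
by move=> /(congr1 val) /= /keyP; rewrite er er'.
Qed.

End HalfplaneClasses.

(** * Shattered sets on one side of the viewpoints *)

Section ShatteredPairs.
Import boot.fintype boot.finset.
Local Open Scope set_scope.
Local Open Scope ring_scope.
Variable R : realType.
Local Notation plane := (R * R)%type.
Variables (P : set plane) (I : finType) (x : I -> plane) (y : {set I} -> plane).
Variable F : {set {set I}}.
Hypothesis Phf : hole_free P.
Hypothesis ox : forall e, see P 0 (x e).
Hypothesis oy : forall T, T \in F -> see P 0 (y T).
Hypothesis xy : forall T e, T \in F -> see P (x e) (y T) <-> e \in T.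
Implicit Types (G : {set {set I}}) (A T : {set I}).

Lemma cr_antisym (p q : plane) : cr p q = - cr q p.
Proof. by rewrite /cr; ring. Qed.

Lemma cr_unseen T e : T \in F -> e \notin T -> cr (x e) (y T) != 0.
Proof.
move=> TF; apply: contra => /eqP h; apply/(xy _ TF).
by apply: see_parallel => //; exact: oy.
Qed.

Definition nonneg_on G A := {in G & A, forall T e, 0 <= cr (x e) (y T)}.

Lemma shattered_order T1 T2 i j : T1 \in F -> T2 \in F ->
  0 <= cr (x i) (y T1) -> 0 <= cr (x j) (y T1) ->
  0 <= cr (x i) (y T2) -> 0 <= cr (x j) (y T2) -> 0 < cr (x i) (x j) ->
  j \in T1 -> i \notin T1 -> i \in T2 -> j \notin T2 -> 0 < cr (y T1) (y T2).
Proof.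
move=> F1 F2 i1 j1 i2 j2 ij jT1 iT1 iT2 jT2.
apply: (pair_order Phf (ox i) (ox j) (oy F1) (oy F2) ij) => //.
- exact/xy.
- by move/(xy _ F1); apply/negP.
- exact/xy.
- by move/(xy _ F2); apply/negP.
Qed.

Section Shattered.
Variables (G : {set {set I}}) (A : {set I}).
Hypotheses (GF : G \subset F) (GA : shatters G A) (GA0 : nonneg_on G A).

Lemma trace (B : {set I}) : B \subset A -> exists2 T, T \in G &
  [/\ T \in F, {in A, forall e, (e \in T) = (e \in B)} &
      {in A, forall e, 0 <= cr (x e) (y T)}].
Proof.
move=> /(shattersP _ _ GA)[T TG e]; exists T => //; split.
- exact: (subsetP GF).
- by move=> f fA; rewrite -e inE fA andbT.
- by move=> f fA; apply: GA0.
Qed.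

(** If [x i] and [x j] were collinear with [0], a viewpoint seeing neither would show that they are
    on one ray. By [parallel_pair] the nearer one is then seen whenever the farther one is, so the
    trace consisting of the farther one alone is missing. *)
Lemma shattered_cr_neq0 i j : i \in A -> j \in A -> i != j ->
  cr (x i) (x j) != 0.
Proof.
(* Assume that [j] is the nearer one, as measured from a viewpoint that sees neither. *)
wlog ij : i j / forall T, T \in G -> i \notin T -> j \notin T ->
    exists2 T', T' \in G & [/\ i \notin T', j \notin T' &
      cr (x j) (y T') <= cr (x i) (y T')].
  move=> W iA jA ij.
  have [T TG [TF Tt T0]] := trace (sub0set A).
  have iT : i \notin T by rewrite Tt// inE.
  have jT : j \notin T by rewrite Tt// inE.
  have [h|h] := leP (cr (x j) (y T)) (cr (x i) (y T)).
    by apply: W => // T' _ _ _; exists T.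
  rewrite cr_antisym oppr_eq0; apply: W; rewrite // 1?eq_sym// => T' _ _ _.
  by exists T => //; split => //; exact: ltW.
move=> iA jA ne; apply/eqP => cr0.
have [T TG [TF Tt _]] := trace (sub0set A).
have [||T' T'G [iT' jT' le]] := ij T TG; rewrite ?Tt ?inE//.
have T'F := subsetP GF _ T'G.
have [T1 T1G [T1F T1t T10]] : exists2 T, T \in G &
    [/\ T \in F, {in A, forall e, (e \in T) = (e \in [set i])} &
      {in A, forall e, 0 <= cr (x e) (y T)}] by apply: trace; rewrite sub1set.
have : see P (x j) (y T1).
  apply: (parallel_pair Phf (ox i) (ox j) cr0 _ le (oy T1F)).
  - by rewrite lt_neqAle eq_sym cr_unseen// GA0.
  - exact: T10.
  - by apply/xy => //; rewrite T1t// inE.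
by move/(xy _ T1F); rewrite T1t// inE eq_sym (negPf ne).
Qed.

(** Among three points there are [p], [q], [r] such that [q] follows [p] and [r] follows [q], as a
    tournament has a Hamiltonian path. By [shattered_order], the viewpoints with traces [{q}] and
    [{p, r}] would have to precede each other. *)
Lemma card_shattered : (#|A| <= 2)%N.
Proof.
rewrite leqNgt; apply/card_gt2P => -[a [b [c [[aA bA cA] [ab bc ca]]]]].
have path p q r : p \in A -> q \in A -> r \in A -> p != q -> q != r -> r != p ->
    0 < cr (x p) (x q) -> 0 < cr (x q) (x r) -> False.
  move=> pA qA rA pq qr rp cpq cqr.
  have [|T1 _ [F1 t1 n1]] := @trace [set q]; first by rewrite sub1set.
  have [|T2 _ [F2 t2 n2]] := @trace [set p; r]; first by rewrite subUset !sub1set pA.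
  have h1 : 0 < cr (y T1) (y T2).
    apply: (shattered_order F1 F2 _ _ _ _ cpq); rewrite ?n1 ?n2 ?t1 ?t2//;
      by rewrite !inE ?eqxx ?(negPf pq) ?(negPf qr)// eq_sym (negPf pq).
  have h2 : 0 < cr (y T2) (y T1).
    apply: (shattered_order F2 F1 _ _ _ _ cqr); rewrite ?n1 ?n2 ?t1 ?t2//;
      rewrite !inE ?eqxx ?orbT ?(negPf qr) ?orbF//; first by rewrite eq_sym.
    by rewrite eq_sym.
  by move: h1 h2; rewrite cr_antisym oppr_gt0 => h /(lt_trans h); rewrite ltxx.
have dir p q : p \in A -> q \in A -> p != q ->
    0 < cr (x p) (x q) \/ 0 < cr (x q) (x p).
  move=> pA qA pq; have := shattered_cr_neq0 pA qA pq.
  rewrite neq_lt => /orP[h|]; [right|by left].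
  by rewrite cr_antisym oppr_gt0.
have ba : b != a by rewrite eq_sym.
have cb : c != b by rewrite eq_sym.
have ac : a != c by rewrite eq_sym.
case: (dir a b aA bA ab) => h1; case: (dir b c bA cA bc) => h2;
  case: (dir c a cA aA ca) => h3.
- exact: (path a b c).
- exact: (path a b c).
- exact: (path c a b).
- exact: (path a c b).
- exact: (path b c a).
- exact: (path b a c).
- exact: (path c b a).
- exact: (path c b a).
Qed.

End Shattered.

(* By the Pluecker relations in the plane, [e] would lie on both sides of [i]. *)
Lemma shattered_once G G' A i j e : G \subset F -> G' \subset F ->
  shatters G A -> shatters G' A -> nonneg_on G A -> nonneg_on G' A ->
  i \in A -> j \in A -> i != j ->
  {in G & G', forall T T', [/\ 0 <= cr (x e) (y T), cr (x e) (y T') <= 0 &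
    cr (x e) (y T') < cr (x e) (y T)]} -> False.
Proof.
move=> GF GF' GA GA' GA0 GA0'.
wlog ij : i j / 0 < cr (x i) (x j).
  move=> W iA jA ij; have := shattered_cr_neq0 GF GA GA0 iA jA ij.
  rewrite neq_lt => /orP[h|h]; [apply: (W j i)|apply: (W i j)] => //.
    by rewrite cr_antisym oppr_gt0.
  by rewrite eq_sym.
move=> iA jA ne h.
have jA1 : [set j] \subset A by rewrite sub1set.
have iA1 : [set i] \subset A by rewrite sub1set.
have [T1 G1 [F1 t1 n1]] := trace GF GA GA0 jA1.
have [T2 G2 [F2 t2 n2]] := trace GF GA GA0 iA1.
have [T1' G1' [F1' t1' n1']] := trace GF' GA' GA0' jA1.
have [T2' G2' [F2' t2' n2']] := trace GF' GA' GA0' iA1.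
have iT1 : i \notin T1 by rewrite t1// inE.
have iT1' : i \notin T1' by rewrite t1'// inE.
have o12' : 0 < cr (y T1) (y T2').
  apply: (shattered_order F1 F2' _ _ _ _ ij); rewrite ?n1 ?n2' ?t1 ?t2'//;
    by rewrite !inE ?eqxx// eq_sym.
have o1'2 : 0 < cr (y T1') (y T2).
  apply: (shattered_order F1' F2 _ _ _ _ ij); rewrite ?n1' ?n2 ?t1' ?t2//;
    by rewrite !inE ?eqxx// eq_sym.
have i1 : 0 < cr (x i) (y T1) by rewrite lt_neqAle eq_sym cr_unseen// n1.
have i1' : 0 < cr (x i) (y T1') by rewrite lt_neqAle eq_sym cr_unseen// n1'.
have i2 := n2 _ iA; have i2' := n2' _ iA.
have [e1 e2' d12'] := h _ _ G1 G2'.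
have [e2 e1' d21'] := h _ _ G2 G1'.
have p1 : cr (x e) (x i) * cr (y T1) (y T2') =
    cr (x e) (y T1) * cr (x i) (y T2') - cr (x e) (y T2') * cr (x i) (y T1).
  by rewrite /cr; ring.
have p2 : cr (x e) (x i) * cr (y T1') (y T2) =
    cr (x e) (y T1') * cr (x i) (y T2) - cr (x e) (y T2) * cr (x i) (y T1').
  by rewrite /cr; ring.
(* The relations [p1] and [p2] give opposite signs, so [x e] and [x i] are collinear with [0]. They
   then yield [cr (x e) (y T2) <= 0 <= cr (x e) (y T2')], against the strict inequality assumed for
   [T2] and [T2']. *)
have ei0 : 0 <= cr (x e) (x i).
  rewrite -(pmulr_lge0 _ o12') p1 addr_ge0 ?mulr_ge0// -mulNr mulr_ge0 ?oppr_ge0//.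
  exact: ltW.
have ei0' : cr (x e) (x i) <= 0.
  rewrite -(pmulr_lle0 _ o1'2) p2 -oppr_ge0 opprB addr_ge0 ?mulr_ge0 ?(ltW i1')//.
  by rewrite -mulNr mulr_ge0 ?oppr_ge0.
have ei : cr (x e) (x i) = 0 by apply/eqP; rewrite eq_le ei0 ei0'.
move: p1 p2; rewrite ei !mul0r => /esym/eqP; rewrite subr_eq0 => /eqP p1.
move=> /esym/eqP; rewrite subr_eq0 => /eqP p2.
have [_ _] := h _ _ G2 G2'; rewrite ltNge => /negP; apply.
apply: (@le_trans _ _ 0).
  by rewrite -(pmulr_lle0 _ i1') -p2 mulr_le0_ge0.
by rewrite -(pmulr_lge0 _ i1) -p1 mulr_ge0.
Qed.

End ShatteredPairs.

(** * Counting shattered sets *)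

Section ShatteredCount.
Import boot.fintype boot.finset.
Local Open Scope set_scope.
Local Open Scope nat_scope.

(** Double counting: each [A] belongs to at most one [p s]. *)
Lemma leq_sum_card_disjoint (J K : finType) (C : {set J}) (D : {set K})
    (p : J -> {set K}) : (forall s, s \in C -> p s \subset D) ->
  (forall s t A, s \in C -> t \in C -> A \in p s -> A \in p t -> s = t) ->
  \sum_(s in C) #|p s| <= #|D|.
Proof.
move=> pD pdis.
have -> : \sum_(s in C) #|p s| = \sum_(s in C) \sum_(A in D) (A \in p s).
  apply: eq_bigr => s sC; rewrite -sum1_card big_mkcond [RHS]big_mkcond /=.
  apply: eq_bigr => A _; have := subsetP (pD s sC) A.
  by case: (A \in p s) => [->|]//; case: ifP.
rewrite exchange_big /= -sum1_card; apply: leq_sum => A _.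
have -> : \sum_(s in C) (A \in p s) = #|[set s in C | A \in p s]|.
  rewrite -sum1_card big_mkcond [RHS]big_mkcond /=; apply: eq_bigr => s _.
  by rewrite inE; case: (s \in C); case: (A \in p s).
apply/card_le1_eqP => s t; rewrite !inE => /andP[sC As] /andP[tC At].
exact: (pdis t s A).
Qed.

Variable I : finType.
Implicit Types (G : {set {set I}}) (S A : {set I}).

Definition shattered_in G S := [set A | shatters G A & A \subset S].

Definition shattered_pairs G S := [set A in shattered_in G S | #|A| == 2].

(** By [card_shatters] it is enough to count shattered sets, and such a set is determined by its
    parts inside and outside [S], both shattered. *)
Lemma card_shattered_in_setC G S :
  #|G| <= #|shattered_in G S| * #|shattered_in G (~: S)|.
Proof.
apply: leq_trans (card_shatters G) _.
rewrite -cardsX.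
rewrite -(card_in_imset (f := fun A => (A :&: S, A :\: S)) (D := mem [set A | shatters G A])).
  apply/subset_leq_card/subsetP => _ /imsetP[A + ->]; rewrite inE => GA.
  rewrite !inE subsetIr (shattersS (subxx G) (subsetIl _ _) GA) /=.
  by rewrite (shattersS (subxx G) (subsetDl _ _) GA) /= setDE subsetIr.
by move=> A B _ _ [e1 e2]; rewrite -(setID A S) e1 e2 setID.
Qed.

(** The three summands count the sets of size zero, one and two. *)
Lemma card_shattered_in G S O :
  (forall A, A \in shattered_in G S -> A \subset ~: O /\ #|A| <= 2) ->
  #|shattered_in G S| <= 1 + #|S :\: O| + #|shattered_pairs G S| /\
  #|shattered_pairs G S| <= 'C(#|S :\: O|, 2).
Proof.
move=> h; split.
  have sub : shattered_in G S \subset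
      [set set0] :|: [set [set e] | e in S :\: O] :|: shattered_pairs G S.
    apply/subsetP => A AS; have [AO] := h _ AS.
    rewrite leq_eqVlt => /orP[A2|]; first by rewrite inE [X in _ || X]inE AS A2 orbT.
    rewrite ltnS leq_eqVlt => /orP[/cards1P[e Ae]|]; last first.
      by rewrite ltnS leqn0 cards_eq0 => /eqP ->; rewrite !inE eqxx.
    rewrite inE; apply/orP; left; rewrite inE; apply/orP; right; apply/imsetP.
    exists e => //; move: AS AO; rewrite inE Ae !sub1set => /andP[_ eS].
    by rewrite !inE => ->.
  apply: (leq_trans (subset_leq_card sub)).
  apply: (leq_trans (leq_card_setU _ _)); rewrite leq_add2r.
  apply: (leq_trans (leq_card_setU _ _)); rewrite cards1 leq_add2l.
  exact: leq_imset_card.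
rewrite -cards_draws; apply/subset_leq_card/subsetP => A.
rewrite /shattered_pairs inE => /andP[AS A2]; rewrite inE A2 andbT setDE subsetI.
have [-> _] := h _ AS; rewrite andbT.
by move: AS; rewrite inE => /andP[].
Qed.

(** Both sides are affine in [p] and in [q], so for each [a] the corners of the range decide. The
    balanced case [a = b = 6] dictates the constants: [49 = 7 * 7] is the value at [p = q = 0], and
    [22 * 22 = 484] at [p = q = 15] needs an integer factor of at least 15. *)
Lemma split_count_bound a b p q : a + b = 12 -> p <= 'C(a, 2) -> q <= 'C(b, 2) ->
  (1 + a + p) * (1 + b + q) <= 49 + 15 * (p + q).
Proof.
move=> ab; have -> : b = 12 - a by lia.
have : a <= 12 by lia.
clear b ab; do 13![case: a => [|a]; [move=> _;
  repeat match goal with |- context [binomial ?m ?k] =>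
    let v := eval vm_compute in (binomial m k) in change (binomial m k) with v
  end;
  repeat match goal with |- context [12 - ?m] =>
    let v := eval vm_compute in (12 - m) in change (12 - m) with v
  end; nia|]].
lia.
Qed.

Lemma card_supersets (O : {set I}) :
  #|[set T : {set I} | O \subset T]| = 2 ^ #|~: O|.
Proof.
rewrite -card_powerset.
rewrite -(card_in_imset (f := fun B => O :|: B) (D := mem (powerset (~: O)))).
  apply: eq_card => T; rewrite inE; apply/idP/imsetP => [OT|[B _ ->]].
    by exists (T :\: O); [rewrite powersetE setDE subsetIr|rewrite -{1}(setIidPr OT) setID].
  exact: subsetUl.
move=> A B; rewrite !powersetE => AO BO e.
have E (C : {set I}) : C \subset ~: O -> (O :|: C) :\: O = C.
  by move=> CO; rewrite setDUl setDv set0U setDE; apply/setIidPl.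
by rewrite -(E A AO) e E.
Qed.

End ShatteredCount.

(** * The count *)

Section StarCount.
Import boot.fintype boot.finset.
Local Open Scope set_scope.
Local Open Scope ring_scope.
Variable R : realType.
Local Notation plane := (R * R)%type.
Implicit Types (P : classical_sets.set plane) (p q : plane).

(** A reflection, which exchanges left and right, so that results for one side carry over to the
    other. *)
Definition flip p : plane := (p.2, p.1).

Definition flipped P : classical_sets.set plane := fun p => P (flip p).

Lemma flipK : involutive flip. Proof. by case. Qed.

Lemma cr_flip p q : cr (flip p) (flip q) = - cr p q.
Proof. by rewrite /cr /=; ring. Qed.

Lemma see_flipped P p q : see (flipped P) (flip p) (flip q) <-> see P p q.
Proof. by split=> h t /h. Qed.

Lemma hole_free_flipped P : hole_free P -> hole_free (flipped P).
Proof.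
move=> Phf z v a b.
rewrite -(flipK z) -(flipK v) -(flipK a) -(flipK b) !see_flipped.
move: (flip z) (flip v) (flip a) (flip b) => {}z {}v {}a {}b za av vb bz.
have E p q r : cr (flip p - flip q) (flip r - flip q) = - cr (p - q) (r - q).
  by rewrite /cr /=; ring.
rewrite !E oppr_gt0 oppr_lt0 => cra crb.
by apply: (Phf z v b a) => //; exact: see_sym.
Qed.

Lemma star_count P (x : 'I_15 -> plane) (O : {set 'I_15})
    (y : {set 'I_15} -> plane) :
  hole_free P -> (forall e, see P 0 (x e)) -> #|O| = 3%N ->
  (forall T : {set 'I_15}, O \subset T -> see P 0 (y T)) ->
  (forall (T : {set 'I_15}) e, O \subset T -> see P (x e) (y T) <-> e \in T) -> False.
Proof.
move=> Phf ox O3 oy xy.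
pose F := [set T : {set 'I_15} | O \subset T].
have oyF T : T \in F -> see P 0 (y T) by rewrite inE; exact: oy.
have xyF T e : T \in F -> see P (x e) (y T) <-> e \in T by rewrite inE; exact: xy.
have Phf' := hole_free_flipped Phf.
have ox' e : see (flipped P) 0 (flip (x e)) by exact/(see_flipped P 0).
have oy' T : T \in F -> see (flipped P) 0 (flip (y T)).
  by move=> TF; apply/(see_flipped P 0); exact: oyF.
have xy' T e : T \in F -> see (flipped P) (flip (x e)) (flip (y T)) <-> e \in T.
  by move=> TF; rewrite see_flipped; exact: xyF.
pose cl T := left_of x (y T).
pose C := [set cl T | T in F].
pose G (s : {set 'I_15}) := [set T in F | cl T == s].
have GF s : G s \subset F by apply/subsetP => T; rewrite inE => /andP[].
(* All members of [G s] contain [O], so one with empty trace on [A] shows that [A] misses [O]. *)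
have GO s A : shatters (G s) A -> A \subset ~: O.
  move=> /shattersP/(_ set0 (sub0set A))[T]; rewrite !inE => /andP[OT _] TA.
  rewrite -disjoints_subset -setI_eq0 -subset0 -TA setIC.
  exact: setSI.
have clE s T e : T \in G s -> (e \in s) = (0 <= cr (x e) (y T)).
  by rewrite inE => /andP[_ /eqP <-]; rewrite inE.
have nnl (s A : {set 'I_15}) : A \subset s -> nonneg_on x y (G s) A.
  by move=> As T e TG /(subsetP As) es; rewrite -(clE s).
have nnr (s A : {set 'I_15}) : A \subset ~: s ->
    nonneg_on (fun e => flip (x e)) (fun T => flip (y T)) (G s) A.
  move=> As T e TG /(subsetP As); rewrite inE (clE s T)// -ltNge cr_flip oppr_ge0.
  exact: ltW.
have inl s A : A \in shattered_in (G s) s -> A \subset ~: O /\ (#|A| <= 2)%N.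
  rewrite inE => /andP[GA As]; split; first exact: GO GA.
  by apply: (card_shattered Phf ox oyF xyF (GF s) GA); exact: nnl.
have inr s A : A \in shattered_in (G s) (~: s) -> A \subset ~: O /\ (#|A| <= 2)%N.
  rewrite inE => /andP[GA As]; split; first exact: GO GA.
  by apply: (card_shattered Phf' ox' oy' xy' (GF s) GA); exact: nnr.
have disl s t A : s \in C -> t \in C -> A \in shattered_pairs (G s) s ->
    A \in shattered_pairs (G t) t -> s = t.
  move=> _ _; rewrite !inE => /andP[/andP[GsA As] A2] /andP[/andP[GtA At] _].
  have /card_gt1P[i [j [iA jA ij]]] : (1 < #|A|)%N by rewrite (eqP A2).
  (* Different splittings differ in some [e], whose line through [0] separates the viewpoints of
     [G s] from those of [G t], as [shattered_once] requires. *)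
  wlog [e es et] : s t GsA As GtA At / exists2 e, e \in s & e \notin t.
    move=> W; apply/eqP; rewrite eqEsubset; apply/andP; split;
      apply: contraT => /subsetPn[e e1 e2].
      have st := W s t GsA As GtA At (ex_intro2 _ _ e e1 e2).
      by rewrite -st e1 in e2.
    have ts := W t s GtA At GsA As (ex_intro2 _ _ e e1 e2).
    by rewrite -ts e1 in e2.
  exfalso; apply: (shattered_once Phf ox oyF xyF (GF s) (GF t) GsA GtA
    (nnl s A As) (nnl t A At) iA jA ij (e := e)) => T T' TG TG'.
  move: es et; rewrite (clE s T)// (clE t T')// -ltNge => es et.
  by split => //; [exact: ltW|exact: lt_le_trans es].
have disr s t A : s \in C -> t \in C -> A \in shattered_pairs (G s) (~: s) ->
    A \in shattered_pairs (G t) (~: t) -> s = t.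
  move=> _ _; rewrite !inE => /andP[/andP[GsA As] A2] /andP[/andP[GtA At] _].
  have /card_gt1P[i [j [iA jA ij]]] : (1 < #|A|)%N by rewrite (eqP A2).
  wlog [e es et] : s t GsA As GtA At / exists2 e, e \notin s & e \in t.
    move=> W; apply/eqP; rewrite eqEsubset; apply/andP; split;
      apply: contraT => /subsetPn[e e1 e2].
      have ts := W t s GtA At GsA As (ex_intro2 _ _ e e2 e1).
      by rewrite ts e1 in e2.
    have st := W s t GsA As GtA At (ex_intro2 _ _ e e2 e1).
    by rewrite st e1 in e2.
  exfalso; apply: (shattered_once Phf' ox' oy' xy' (GF s) (GF t) GsA GtA
    (nnr s A As) (nnr t A At) iA jA ij (e := e)) => T T' TG TG'.
  move: es et; rewrite (clE s T)// (clE t T')// -ltNge !cr_flip => es et.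
  rewrite oppr_ge0 oppr_le0 ltrN2.
  by split => //; [exact: ltW|exact: lt_le_trans et].
pose D := [set A : {set 'I_15} | A \subset ~: O & #|A| == 2%N].
have O12 : #|~: O| = 12%N by have := cardsC O; rewrite O3 card_ord => -[].
have D66 : #|D| = 66%N by rewrite cards_draws O12.
have suml : (\sum_(s in C) #|shattered_pairs (G s) s| <= 66)%N.
  rewrite -D66; apply: leq_sum_card_disjoint disl => s _.
  apply/subsetP => A; rewrite inE => /andP[/inl[AO _] A2].
  by rewrite inE AO A2.
have sumr : (\sum_(s in C) #|shattered_pairs (G s) (~: s)| <= 66)%N.
  rewrite -D66; apply: leq_sum_card_disjoint disr => s _.
  apply/subsetP => A; rewrite inE => /andP[/inr[AO _] A2].
  by rewrite inE AO A2.
(* Here [35 = 2 * (15 + 1) + 3]. *)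
have C35 : (#|C| <= 35)%N.
  apply: leq_trans (_ : _ <= 2 * #|'I_15|.+1 + 3)%N _; last by rewrite card_ord.
  apply: leq_trans (card_left_of x y); apply/subset_leq_card/imsetS.
  exact/subsetP.
have FE : #|F| = (\sum_(s in C) #|G s|)%N.
  rewrite -sum1_card (partition_big cl (mem C)) /=; last first.
    by move=> T TF; apply/imsetP; exists T.
  apply: eq_bigr => s _; rewrite -sum1_card; apply: eq_bigl => T.
  by rewrite [in RHS]inE.
have Gs s : (#|G s| <= 49 + 15 *
    (#|shattered_pairs (G s) s| + #|shattered_pairs (G s) (~: s)|))%N.
  have [l1 l2] := card_shattered_in (inl s).
  have [r1 r2] := card_shattered_in (inr s).
  apply: leq_trans (card_shattered_in_setC (G s) s) _.
  apply: leq_trans (leq_mul l1 r1) _.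
  apply: split_count_bound => //.
  by apply: etrans O12; rewrite -[RHS](cardsID s) !setDE ![in RHS](setIC (~: O)).
have : (#|F| <= 49 * 35 + 15 * (66 + 66))%N.
  have : (\sum_(s in C) #|G s| <= \sum_(s in C) (49 + 15 *
      (#|shattered_pairs (G s) s| + #|shattered_pairs (G s) (~: s)|)))%N.
    by apply: leq_sum => s _; exact: Gs.
  rewrite -FE big_split /= sum_nat_const -big_distrr /= big_split /=.
  move=> h; apply: (leq_trans h); apply: leq_add.
    by rewrite mulnC leq_mul2l C35.
  by rewrite leq_mul2l /= leq_add.
by rewrite card_supersets O12.
Qed.

End StarCount.

(** * From fifteen shattered points to the dimension *)

Section ShatteredPolygon.
Variable R : realType.
Local Notation plane := (R * R)%type.
Implicit Types P S : set plane.

Lemma exists_superset (I : finType) (A : {set I}) n :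
  (#|A| <= n <= #|I|)%N -> exists2 B : {set I}, A \subset B & #|B| = n.
Proof.
elim: n => [|n IH] /andP[An nI].
  by exists A => //; apply/eqP; rewrite -leqn0.
move: An; rewrite leq_eqVlt => /orP[/eqP An|]; first by exists A.
rewrite ltnS => An; have [|B AB Bn] := IH; first by rewrite An ltnW.
have [e eB] : exists e, e \notin B.
  apply/existsP; rewrite -negb_forall; apply/negP => /forallP h.
  by move: nI; rewrite -Bn ltnNge => /negP; apply; apply/subset_leq_card/fintype.subsetP.
exists (e |: B)%SET; last by rewrite cardsU1 eB Bn.
exact: fintype.subset_trans (finset.subsetU1 e B).
Qed.

Lemma not_all_seen P (s : 'I_15 -> plane) : hole_free P -> closed P ->
  (forall T : {set 'I_15}, exists v, forall e, see P v (s e) <-> e \in T) ->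
  False.
Proof.
move=> Phf Pc /choice[v vP].
have [z [zs [i [j [k ijk]]]]] : exists z, (forall i, see P z (s i)) /\
    exists i j k, forall v, see P v (s i) -> see P v (s j) -> see P v (s k) ->
      see P v z.
  by apply: (centre Phf Pc (c := v finset.setT)) => e; apply/vP; rewrite finset.in_setT.
(* The indices [i], [j], [k] may coincide, so they are completed to a set of exactly three. *)
have [|O ijkO O3] := @exists_superset 'I_15 [set i; j; k]%SET 3.
  by rewrite card_ord (leq_trans (leq_card_setU _ _))// cards1 cards2; case: (_ != _).
have iO : i \in O by apply: (fintype.subsetP ijkO); rewrite !inE eqxx.
have jO : j \in O by apply: (fintype.subsetP ijkO); rewrite !inE eqxx orbT.
have kO : k \in O by apply: (fintype.subsetP ijkO); rewrite !inE eqxx orbT.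
have vz (T : {set 'I_15}) : O \subset T -> see P (v T) z.
  by move=> /fintype.subsetP OT; apply: ijk; apply/vP; exact: OT.
have tr p q : see (translate P z) (p - z) (q - z) <-> see P p q.
  by rewrite see_translate !subrK.
have tr0 q : see P z q -> see (translate P z) 0 (q - z).
  by move=> zq; rewrite -(subrr z); exact/tr.
pose x e : plane := s e - z; pose y (T : {set 'I_15}) : plane := v T - z.
apply: (@star_count R (translate P z) x O y) => //.
- exact: hole_free_translate.
- by move=> e; exact/tr0/zs.
- by move=> T OT; apply: tr0; apply: see_sym; exact: vz.
- move=> T e _; split=> [/(tr (s e) (v T)) h|eT].
    by apply/vP; exact: see_sym.
  by apply/(tr (s e) (v T)); apply: see_sym; exact/vP.
Qed.

Lemma simple_polygon_hole_free P : simple_polygon P -> hole_free P /\ closed P.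
Proof.
move=> [n [p [_ _ ->]]]; split; first exact: hole_free_enclosed_region.
exact/closed_enclosed_region/closed_polygonal_curve.
Qed.

Lemma not_shattered P S : simple_polygon P -> S `<=` P -> S #= `I_15 ->
  ~ (forall T, T `<=` S -> exists2 v, P v & T = vis P v `&` S).
Proof.
move=> /simple_polygon_hole_free[Phf Pc] SP.
rewrite card_eq_sym => /card_set_bijP[f [fS finj fsurj]] h.
pose s (e : 'I_15) := f e.
have sS e : S (s e) by apply: fS => /=.
apply: (@not_all_seen P s Phf Pc) => T.
have [|v Pv vT] := h [set s e | e in [set` T]]; first by move=> _ [e _ <-].
exists v => e; split=> [ve|eT].
  have : (vis P v `&` S) (s e).
    split => //; split; first exact: SP.
    by apply/see_segment; exact: see_sym.
  rewrite -vT => -[e' e'T /finj e'e].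
  suff -> : e = e' by [].
  by apply/val_inj/esym/e'e; rewrite inE /=.
have : (vis P v `&` S) (s e) by rewrite -vT; exists e.
by move=> [[_ /see_segment sv] _]; exact: see_sym.
Qed.

(** Shattering passes to subsets, so fifteen of the points already give the contradiction. *)
Lemma realizable_leq14 m : realizable R m -> (m <= 14)%N.
Proof.
move=> [P [S [Ps SP Sm h]]]; rewrite leqNgt; apply/negP => m15.
move: Sm; rewrite card_eq_sym => /card_set_bijP[f [fS finj fsurj]].
have sub : `I_15 `<=` `I_m by move=> n /= n15; exact: leq_trans m15.
have S'S : f @` `I_15 `<=` S by move=> _ [n /sub nm <-]; exact: fS.
apply: (@not_shattered P (f @` `I_15)) => //.
- exact: subset_trans SP.
- by apply: inj_card_eq => a b; rewrite !inE => /sub am /sub bm; apply: finj; rewrite inE.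
- move=> T TS'; have [_ [v Pv vT]] := h T (subset_trans TS' S'S).
  exists v => //; apply/seteqP; split=> [p Tp|p [pv /S'S pS]].
    by split; [move: Tp; rewrite vT => -[]|exact: TS'].
  by rewrite vT.
Qed.

Definition triangle (i : 'I_3) : plane :=
  match nat_of_ord i with 0%N => (0, 0) | 1%N => (1, 0) | _ => (0, 1) end.

Lemma triangle_side i (t : R) : affine_path (triangle i) (triangle (ordS i)) t =
  match nat_of_ord i with 0%N => (t, 0) | 1%N => (1 - t, t) | _ => (0, 1 - t) end.
Proof.
by case: i => -[|[|[|//]]] i3; apply: plane_eq; rewrite affine_pathE /triangle /=; ring.
Qed.

(** A largest realizable number exists only if some number is realizable; a triangle with no points
    provides one. *)
Lemma realizable0 : realizable R 0.
Proof.
exists (enclosed_region (polygonal_curve triangle)), set0; split.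
- exists 3%N, triangle; split => // i j s t s01 t01.
  rewrite !triangle_side; case: i => -[|[|[|//]]] i3;
    case: j => -[|[|[|//]]] j3 /= e;
    have /= := congr1 fst e; have /= := congr1 snd e => e2 e1;
    by first [split; [exact/val_inj|lra]|exfalso; lra].
- by move=> ?.
- by rewrite II0.
- move=> T T0; split => //; exists (0, 0).
    left; exists ord0 => //; exists 0; first by rewrite /= in_itv /= lexx ler01.
    by rewrite triangle_side.
  by rewrite setI0; apply/seteqP; split.
Qed.

End ShatteredPolygon.

Theorem theorem1 (R : realType) :
  (exists d : nat, is_VC_dimension R d /\ (d <= 14)%N) /\
  (forall P S : set (R * R)%type,
     simple_polygon P -> S `<=` P -> S #= `I_15 ->
     exists T : set (R * R)%type,
       T `<=` S /\ forall v : (R * R)%type, P v -> T <> vis P v `&` S).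
Proof.
split.
  have ex : exists m, `[< realizable R m >] by exists 0%N; apply/asboolP/realizable0.
  have bd m : `[< realizable R m >] -> (m <= 14)%N.
    by move/asboolP/realizable_leq14.
  case: (ex_maxnP ex bd) => d /asboolP dr dmax; exists d; split.
    by split => // m mr; apply: dmax; exact/asboolP.
  exact: realizable_leq14 dr.
move=> P S Ps SP S15; apply: contrapT => /forallNP h.
apply: (not_shattered Ps SP S15) => T TS.
apply: contrapT => nv; apply: (h T); split => // v Pv vT.
by apply: nv; exists v.
Qed.
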